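(* Let $I=\langle x^{a_i}y^{b_i}\mid 0\le i\le r\rangle$ be a monomial ideal of $R$ with $r\ge 2$, $a_0>a_1>\dots>a_{r-1}>a_r=0$, $b_0=0<b_1<\dots<b_{r-1}<b_r$ and $a_0\le b_r$. Let $M=M(I;e)$ where $2\le e\le r$. Then the following are equivalent: (1) $I(M)$ is integrally closed. (2) $M$ is integrally closed.
   Context: $(R,\mathfrak m)$ is a two-dimensional regular local ring with infinite residue field, and $x,y$ is a fixed regular system of parameters, $\mathfrak m=\langle x,y\rangle$. The module $M(I;e)$: for $I$ as in the claim and $2\le e\le r$, put $a_i'=a_i-e+1$ for $0\le i\le r-e+1$ and $c_i=b_{r-e+1+i}-i$ for $1\le i\le e-1$. Let $\epsilon_1,\dots,\epsilon_e$ be the standard basis of $R^e$. Then $M(I;e)\subset F:=R^e$ is the submodule generated by $f_i=x^{a_i'}y^{b_i}\epsilon_1$ for $0\le i\le r-e+1$, $g_i=y\,\epsilon_i+x\,\epsilon_{i+1}$ for $1\le i\le e-1$, $h_i=y^{c_i}\epsilon_{i+1}$ for $1\le i\le e-1$. For a finitely generated torsion-free $R$-module $M$, the double dual $M^{**}$ is free and contains $M$ with finite-length quotient; $I(M)=\operatorname{Fitt}_0(M^{**}/M)$. (For $M=M(I;e)$ one has $M^{**}=R^e$, so $I(M)$ is the ideal generated by the maximal minors of the matrix whose columns are $f_0,\dots,f_{r-e+1},g_1,\dots,g_{e-1},h_1,\dots,h_{e-1}$.) Integral closure of modules (Rees): with $K$ the fraction field of $R$, $M_K=M\otimes_R K$,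 and $MV$ the image of $M\otimes_R V\to M_K$ for $R\subset V\subset K$, set $\overline M=\{f\in M_K\mid f\in MV$ for every discrete valuation ring $V$ with $R\subset V\subset K\}$; $M$ is integrally closed if $\overline M=M$. *)

(* Defs.v *)
From HB Require Import structures.
From mathcomp Require Import all_boot all_order all_algebra.
From mathcomp Require Import boolp classical_sets functions cardinality.

Set Implicit Arguments.
Unset Strict Implicit.
Unset Printing Implicit Defensive.

Import Order.TTheory GRing.Theory Num.Theory.

Local Open Scope classical_set_scope.
Local Open Scope ring_scope.

(* Finite sums of elements of G with coefficients in A.  With A := setT this is
   the submodule generated by G; with A a subring of the scalars it is the
   A-submodule generated by G. *)
Definition span_over (S : nzRingType) (W : lmodType S) (A : set S) (G : set W) :
    set W :=
  [set w | exists (n : nat) (c : 'I_n -> S) (u : 'I_n -> W),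
     [/\ forall i, A (c i), forall i, G (u i) & w = \sum_(i < n) c i *: u i]].

Definition span (S : nzRingType) (W : lmodType S) (G : set W) : set W :=
  span_over setT G.

Definition ideal_gen (R : comNzRingType) (G : set R) : set R :=
  @span R R^o G.

Definition is_ideal (R : comNzRingType) (J : set R) : Prop :=
  [/\ J 0, forall a b, J a -> J b -> J (a + b) & forall c a, J a -> J (c * a)].

Definition prime_ideal (R : comNzRingType) (P : set R) : Prop :=
  [/\ is_ideal P, ~ P 1 & forall a b, P (a * b) -> P a \/ P b].

Definition maximal_ideal (R : comNzRingType) (m : set R) : Prop :=
  [/\ is_ideal m, ~ m 1
    & forall J, is_ideal J -> ~ J 1 -> m `<=` J -> J = m].

Definition noetherian (R : comNzRingType) : Prop :=
  forall J : set R, is_ideal J -> exists s : seq R, J = ideal_gen [set` s].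

Definition local_ring (R : comNzRingType) (m : set R) : Prop :=
  maximal_ideal m /\ forall m', maximal_ideal m' -> m' = m.

Definition prime_chain (R : comNzRingType) (n : nat) (P : nat -> set R) : Prop :=
  (forall i, (i <= n)%N -> prime_ideal (P i)) /\
  (forall i, (i < n)%N -> P i `<` P i.+1).

Definition krull_dim (R : comNzRingType) (d : nat) : Prop :=
  (exists P : nat -> set R, prime_chain d P) /\
  (forall (n : nat) (P : nat -> set R), prime_chain n P -> (n <= d)%N).

Definition regular_local_ring (R : comNzRingType) (m : set R) (d : nat) : Prop :=
  [/\ noetherian R, local_ring m, krull_dim R d
    & exists s : seq R, size s = d /\ m = ideal_gen [set` s]].

Definition residue_classes (R : comNzRingType) (m : set R) : set (set R) :=
  range (fun a : R => [set b | m (b - a)]).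

(* Hom_R(M, R) for a submodule M of V: an R-linear map on M is encoded by its
   extension by zero to V, so that two encodings are equal iff the maps agree on
   M.  The functions V -> R form an R-module, so the construction iterates. *)
Definition dual (R : comNzRingType) (V : lmodType R) (M : set V) :
    set (V -> R^o) :=
  [set phi | (forall (a : R) (u v : V), M u -> M v ->
                phi (a *: u + v) = a *: phi u + phi v) /\
             (forall u, ~ M u -> phi u = 0)].

Definition eval_at (R : comNzRingType) (V : lmodType R) (M : set V) (u : V) :
    (V -> R^o) -> R^o :=
  fun phi => if `[< dual M phi >] then phi u else 0.

(* Fitt_0(N / M) for submodules M of N: the rows of A are relations among the
   classes of v_1, ..., v_k, which generate N / M.  Letting v range over all
   finite generating families avoids choosing one; by Fitting's lemma each of
   them yields the same ideal. *)
Definition fitting0 (R : comNzRingType) (V : lmodType R) (N M : set V) : set R :=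
  ideal_gen [set d | exists (k : nat) (v : 'I_k -> V) (A : 'M[R]_k),
     [/\ N = span (range v `|` M),
         forall i, M (\sum_(j < k) A i j *: v j) & d = \det A]].

(* I(M) = Fitt_0(M** / M), with M mapped to M** by evaluation. *)
Definition ideal_of_module (R : comNzRingType) (V : lmodType R) (M : set V) :
    set R :=
  fitting0 (dual (dual M)) (eval_at M @` M).

(* The value v 0 is irrelevant. *)
Definition discrete_valuation (K : fieldType) (v : K -> int) : Prop :=
  [/\ forall a b, a != 0 -> b != 0 -> v (a * b) = v a + v b,
      forall a b, a != 0 -> b != 0 -> a + b != 0 ->
        Num.min (v a) (v b) <= v (a + b)
    & forall n : int, exists2 a, a != 0 & v a = n].

Definition discrete_valuation_ring (K : fieldType) (V : set K) : Prop :=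
  exists v : K -> int,
    discrete_valuation v /\ V = [set a | a = 0 \/ 0 <= v a].

(* M is an R-submodule of a vector space W over K = Frac R, so M_K is its
   K-span and MV its V-span in W. *)
Definition integral_closure (R : idomainType) (W : lmodType {fraction R})
    (M : set W) : set W :=
  [set f | span M f /\
     forall V : set {fraction R}, discrete_valuation_ring V ->
       range (@FracField.tofrac R) `<=` V -> span_over V M f].

Definition integrally_closed_module (R : idomainType) (n : nat)
    (M : set 'cV[R]_n) : Prop :=
  let MK := map_mx (@FracField.tofrac R) @` M in integral_closure MK = MK.

(* An ideal is a submodule of R, whose closure is taken in K. *)
Definition integrally_closed_ideal (R : idomainType) (J : set R) : Prop :=
  let JK : set {fraction R}^o := @FracField.tofrac R @` J in
  integral_closure JK = JK.

(* The standard basis of R^e, indexed by 1, ..., e. *)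
Definition eps (R : comNzRingType) (e i : nat) : 'cV[R]_e :=
  \col_(j < e) (j.+1 == i)%:R.
Arguments eps : clear implicits.

(* M(I;e), for I generated by the x^(a i) y^(b i) with i <= r.  All exponents
   are nonnegative when a is strictly decreasing to a r = 0 and b strictly
   increasing from b 0 = 0; a_i - e + 1 is written a i - (e - 1) since a i may
   equal e - 1, and subtraction is truncated. *)
Definition module_of (R : comNzRingType) (x y : R) (r : nat) (a b : nat -> nat)
    (e : nat) : set 'cV[R]_e :=
  span (
    [set (x ^+ (a i - (e - 1)) * y ^+ b i) *: eps R e 1
       | i in [set i : nat | (i <= r - e + 1)%N]]
    `|` [set y *: eps R e i + x *: eps R e i.+1
           | i in [set i : nat | (1 <= i <= e - 1)%N]]
    `|` [set y ^+ (b (r - e + 1 + i)%N - i) *: eps R e i.+1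
           | i in [set i : nat | (1 <= i <= e - 1)%N]]).
Arguments module_of {R} x y r a b e _.

(* Main.v *)
Require Import Defs.
From HB Require Import structures.
From mathcomp Require Import all_boot all_order all_algebra.
From mathcomp Require Import boolp classical_sets functions cardinality.
From mathcomp Require Import ring zify.

Set Implicit Arguments.
Unset Strict Implicit.
Unset Printing Implicit Defensive.

(* [span] is the generated submodule, not the span of a sequence in a vector
   space. *)
Import Defs.
Import Order.TTheory GRing.Theory Num.Theory.

Local Open Scope classical_set_scope.
Local Open Scope ring_scope.

(** Write [e = n + 1] and number coordinates from 0.  The relations
    [y eps_i + x eps_(i+1)] are the syzygies of the monomials of degree [n] in
    the parameters, so the linear form [pairing], whose coefficients are these
    monomials with alternating signs, has them as kernel and sends [R^e] onto
    [m^n] (with [m] the maximal ideal).  Since [M] contains the relations, [M]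
    is the preimage of its image [J], and everything about [M] can be read off
    from the ideal [J].

    The closure of [M] and that of [J] determine each other
    ([closed_transfer]).  For a discrete valuation ring [V] containing [R], say
    with [x] dividing [y] in [V], the kernel of the form on [V^e] multiplied by
    [x] is exactly the [V]-span of the relations.  Hence a vector with
    coordinates in [m] lies in [M V] as soon as its value lies in [J V]
    ([pairing_preimage_valuation]).  Such vectors suffice: [R] is the
    intersection of the valuation rings containing it ([regular_normal]), and
    [J], hence its closure, lies in [m^e], the set of values of the form at
    those vectors; that [m^e] is closed is seen on the [m]-adic valuation
    ([adic_valuation]).

    It remains to see that [I(M) = J] ([ideal_of_module_pairing]).  Evaluation
    identifies the double dual of [M] with [R^e] ([double_dual]), so that
    [I(M)] is generated by the determinants of [e] vectors of [M].  Those
    formed by one vector and all the relations are the elements of [J]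
    ([det_syzygies]).  The others lie in [J] too: [J] is generated by monomials
    whose exponents are strictly monotone, and the expansion of a determinant
    of generators, none of them repeated, only produces multiples of these
    monomials ([det_generators]).

    The facts used about [R] come down to its parameters being a regular
    sequence of primes ([parameters_prime]) and its primes other than [0] and
    [m] being principal ([prime_nonmaximal_principal]).  Both follow from the
    same observation: modulo a parameter every nonzero element is a unit times
    a power of the other one. *)

(** * Spans, ideals and chains *)

Section Spans.
Variables (S : nzRingType) (W : lmodType S).
Implicit Types (A : set S) (G N : set W).

Lemma span_over0 A G : span_over A G 0.
Proof.
by exists 0%N, (fun=> 0), (fun=> 0); split => [[]|[]|] //; rewrite big_ord0.
Qed.

Lemma span_overD A G u v :
  span_over A G u -> span_over A G v -> span_over A G (u + v).
Proof.
move=> [n [c [f [cA fG ->]]]] [k [d [g [dA gG ->]]]].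
exists (n + k)%N.
exists (fun i => match fintype.split i with inl j => c j | inr j => d j end).
exists (fun i => match fintype.split i with inl j => f j | inr j => g j end).
split=> [i|i|]; try by case: (fintype.split i).
rewrite big_split_ord /=; congr (_ + _); apply: eq_bigr => i _.
- by rewrite (unsplitK (inl i)).
- by rewrite (unsplitK (inr i)).
Qed.

Lemma span_overM A G a u :
  A a -> G u -> span_over A G (a *: u).
Proof.
by move=> Aa Gu; exists 1%N, (fun=> a), (fun=> u); split => //; rewrite big_ord1.
Qed.

Lemma span_over_gen A G u : A 1 -> G u -> span_over A G u.
Proof. by move=> A1 Gu; rewrite -[u]scale1r; exact: span_overM. Qed.

Lemma span_over_min A G N : N 0 -> (forall u v, N u -> N v -> N (u + v)) ->
  (forall a u, A a -> G u -> N (a *: u)) -> span_over A G `<=` N.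
Proof.
move=> N0 ND NZ _ [n [c [f [cA fG ->]]]].
by elim/big_ind: _ => // i _; exact: NZ.
Qed.

Lemma spanZ G a u : span G u -> span G (a *: u).
Proof.
move=> [n [c [f [cA fG ->]]]]; exists n, (fun i => a * c i), f; split=> //.
by rewrite scaler_sumr; apply: eq_bigr => i _; rewrite scalerA.
Qed.

Lemma span_gen G u : G u -> span G u.
Proof. exact: span_over_gen. Qed.

Lemma span_sum G n (f : 'I_n -> W) :
  (forall i, span G (f i)) -> span G (\sum_i f i).
Proof.
move=> Gf; elim/big_ind: _ => [|u v|i _]; [exact: span_over0|exact: span_overD|exact: Gf].
Qed.

End Spans.

Section Ideals.
Variable R : comNzRingType.
Implicit Types (G J L : set R).

Lemma ideal_gen_ideal G : is_ideal (ideal_gen G).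
Proof.
split=> [|a b|c a]; [exact: span_over0|exact: span_overD|exact: (@spanZ _ R^o)].
Qed.

Lemma ideal_gen_min G J : is_ideal J -> G `<=` J -> ideal_gen G `<=` J.
Proof.
move=> [J0 JD JM] GJ.
by apply: (@span_over_min _ R^o) => // c u _ /GJ; exact: JM.
Qed.

Lemma idealN J a : is_ideal J -> J a -> J (- a).
Proof. by move=> [_ _ JM] Ja; rewrite -mulN1r; exact: JM. Qed.

Lemma idealB J a b : is_ideal J -> J a -> J b -> J (a - b).
Proof. by move=> iJ Ja Jb; have [_ JD _] := iJ; apply: JD => //; exact: idealN. Qed.

Lemma ideal_sum J (I : Type) (r : seq I) (P : pred I) (F : I -> R) : is_ideal J ->
  (forall i, P i -> J (F i)) -> J (\sum_(i <- r | P i) F i).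
Proof. by move=> [J0 JD JM] JF; elim/big_ind: _. Qed.

Definition multiples (p : R) : set R := [set a | exists c, a = c * p].

Lemma multiples_ideal p : is_ideal (multiples p).
Proof.
split=> [|_ _ [c ->] [d ->]|c _ [d ->]]; first by exists 0; rewrite mul0r.
- by exists (c + d); rewrite mulrDl.
- by exists (c * d); rewrite mulrA.
Qed.

Lemma zero_ideal : is_ideal [set 0 : R].
Proof. by split=> [|a b -> ->|c a ->] //=; rewrite ?addr0 ?mulr0. Qed.

Lemma chain_union_ideal (F : set (set R)) :
  F !=set0 -> F `<=` @is_ideal R -> total_on F subset ->
  is_ideal (\bigcup_(X in F) X).
Proof.
move=> [X0 FX0] Fid tot; split=> [|a b [X FX Xa] [Y FY Yb]|c a [X FX Xa]].
- by exists X0 => //; have [] := Fid _ FX0.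
- have [XY|YX] := tot _ _ FX FY.
  + by exists Y => //; have [_ + _] := Fid _ FY; apply => //; exact: XY.
  + by exists X => //; have [_ + _] := Fid _ FX; apply => //; exact: YX.
- by exists X => //; have [_ _] := Fid _ FX; apply.
Qed.

(** A finite set of generators of the union of a chain already lies in one of
    its members. *)
Lemma noetherian_chain (F : set (set R)) : noetherian R ->
  F !=set0 -> F `<=` @is_ideal R -> total_on F subset ->
  F (\bigcup_(X in F) X).
Proof.
move=> noeth F0 Fid tot.
have [s Us] := noeth _ (chain_union_ideal F0 Fid tot).
suff [X FX sX] : exists2 X, F X & [set` s] `<=` X.
  rewrite (_ : \bigcup_(X in F) X = X) //; apply/seteqP; split; last first.
    by move=> a Xa; exists X.
  by rewrite Us; apply: ideal_gen_min => //; exact: Fid.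
have : [set` s] `<=` \bigcup_(X in F) X.
  by rewrite Us => a sa; exact: (@span_gen _ R^o).
elim: s {Us} => [_|a s IH sU]; first by have [X FX] := F0; exists X.
have [X FX Xa] : (\bigcup_(X in F) X) a by apply: sU; rewrite /= mem_head.
have [|Y FY sY] := IH; first by move=> c cs; apply: sU; rewrite /= inE cs orbT.
have [XY|YX] := tot _ _ FX FY.
- by exists Y => // c /=; rewrite inE => /predU1P[->|/sY//]; exact: XY.
- by exists X => // c /=; rewrite inE => /predU1P[->//|/sY]; exact: YX.
Qed.

Lemma noetherian_maximal (F : set (set R)) : noetherian R ->
  F !=set0 -> F `<=` @is_ideal R ->
  exists2 J, F J & forall J', F J' -> J `<=` J' -> J' = J.
Proof.
move=> noeth [X0 FX0] Fid.
have [|A [[A0|FA] Amax]] := @Zorn_bigcup R [set A | A = set0 \/ F A].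
- move=> E EF tot; have [[X [EX FX]]|nE] := pselect (exists X, E X /\ F X).
  + right; have -> : \bigcup_(X in E) X = \bigcup_(X in E `&` F) X.
      apply/seteqP; split=> [a [Y EY Ya]|a [Y [EY _] Ya]]; last by exists Y.
      by case: (EF _ EY) => [Y0|FY]; [rewrite Y0 in Ya|exists Y].
    have [|||//] := @noetherian_chain (E `&` F) noeth.
    * by exists X.
    * by move=> Y [_ /Fid].
    * by move=> Y Z [EY _] [EZ _]; exact: tot.
  + left; apply/seteqP; split=> // a [Y EY Ya].
    by case: (EF _ EY) => [Y0|FY]; [rewrite Y0 in Ya|case: nE; exists Y].
- have [X00 _ _] := Fid _ FX0.
  case: (Amax X0); last by right.
  by rewrite A0; split=> // /(_ _ X00).
- exists A => // J FJ AJ; apply: contrapT => JA; apply: (Amax J); last by right.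
  by split=> // JA'; apply: JA; apply/seteqP.
Qed.

End Ideals.

Section LocalRing.
Variables (R : idomainType) (m : set R).
Hypotheses (noeth : noetherian R) (loc : local_ring m).

Lemma max_ideal : is_ideal m.
Proof. by case: loc => -[]. Qed.

Lemma max_proper : ~ m 1.
Proof. by case: loc => -[]. Qed.

Lemma proper_sub_max J : is_ideal J -> ~ J 1 -> J `<=` m.
Proof.
move=> iJ J1.
have [|_ [] //|N [iN N1 JN] Nmax] := @noetherian_maximal R
    [set N | [/\ is_ideal N, ~ N 1 & J `<=` N]] noeth; first by exists J; split.
case: loc => _ uniq; rewrite -(uniq N) //; split=> // N' iN' N'1 NN'.
by apply: Nmax => //; split=> // a /JN; exact: NN'.
Qed.

Lemma unit_of_not_max a : ~ m a -> exists c, c * a = 1.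
Proof.
move=> ma; have [[c ac]|na] := pselect (multiples a 1); first by exists c.
by case: ma; apply: (proper_sub_max (multiples_ideal a) na); exists 1; rewrite mul1r.
Qed.

(** A form of both the lemma of Nakayama and the intersection theorem of
    Krull.  The ideals [L + (b_k)] of a descending sequence
    [b_k = q b_(k+1)] modulo [L] form an ascending chain; where it stops,
    [b_(k+1)] lies in [L + (q b_(k+1))], and [1 - c q] is a unit. *)
Lemma descent_sub (L B : set R) (q : R) : is_ideal L -> m q ->
  (forall b, B b -> exists2 b', B b' & L (b - q * b')) -> B `<=` L.
Proof.
move=> iL mq step b0 Bb0; have [L0 LD LM] := iL.
have {step} /choice[f fP] :
    forall b, exists b', B b -> B b' /\ L (b - q * b').
  move=> b; have [Bb|nBb] := pselect (B b); last by exists 0.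
  by have [b' Bb' Lb'] := step _ Bb; exists b'.
pose s k := iter k f b0.
have Bs k : B (s k) by elim: k => //= k IH; exact: (fP _ IH).1.
have sS k : L (s k - q * s k.+1) by exact: (fP _ (Bs k)).2.
pose N k : set R := [set c | exists d, L (c - d * s k)].
have NS k : N k `<=` N k.+1.
  move=> c [d Lc]; exists (d * q).
  rewrite (_ : _ - _ = (c - d * s k) + d * (s k - q * s k.+1)); last by ring.
  by apply: LD => //; exact: LM.
have Nle j k : (j <= k)%N -> N j `<=` N k.
  by move=> /subnKC <-; elim: (k - j)%N => [|i IH]; rewrite ?addn0 ?addnS // => c /IH /NS.
have iN k : is_ideal (N k).
  split=> [|c c' [d Lc] [d' Lc']|c' c [d Lc]].
  - by exists 0; rewrite mul0r subr0.
  - exists (d + d'); rewrite (_ : _ - _ = (c - d * s k) + (c' - d' * s k)); last by ring.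
    exact: LD.
  - by exists (c' * d); rewrite -mulrA -mulrBr; exact: LM.
have [|||K _ UK] := @noetherian_chain R (range N) noeth.
- by exists (N 0%N), 0%N.
- by move=> _ [k _ <-].
- by move=> _ _ [j _ <-] [k _ <-]; case/orP: (leq_total j k) => /Nle; [left|right].
have [d Ld] : N K (s K.+1).
  rewrite UK; exists (N K.+1); first by exists K.+1.
  by exists 1; rewrite mul1r subrr.
have Ls : L (s K.+1).
  have [c cP] : exists c, c * (1 - d * q) = 1.
    apply: unit_of_not_max => m1; apply: max_proper.
    have [_ mD mM] := max_ideal.
    by rewrite -(subrK (d * q) 1); apply: mD => //; exact: mM.
  rewrite -[s _]mul1r -cP -mulrA; apply: (LM).
  rewrite (_ : _ * _ = (s K.+1 - d * s K) + d * (s K - q * s K.+1)); last by ring.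
  by apply: LD => //; exact: LM.
have : forall k, L (s k) -> L (s 0%N).
  elim=> // k IH Lk; apply: IH; rewrite -(subrK (q * s k.+1) (s k)).
  by apply: LD => //; exact: LM.
by move=> /(_ _ Ls).
Qed.

End LocalRing.


(** * Two-dimensional regular local rings *)

Lemma ideal_gen2 (R : comNzRingType) (x y c : R) :
  ideal_gen [set x; y] c <-> exists p q, c = p * x + q * y.
Proof.
split=> [|[p [q ->]]].
  apply: (@ideal_gen_min _ _ [set c | exists p q, c = p * x + q * y]).
  split.
  - by exists 0, 0; rewrite !mul0r addr0.
  - move=> _ _ [p [q ->]] [p' [q' ->]].
    by exists (p + p'), (q + q'); ring.
  - by move=> d _ [p [q ->]]; exists (d * p), (d * q); ring.
  by move=> _ [->|->]; [exists 1, 0|exists 0, 1]; ring.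
have [_ iD iM] := ideal_gen_ideal [set x; y].
by apply: iD; apply: iM; apply: (@span_gen _ R^o); [left|right].
Qed.

Section RegularParameters.
Variables (R : idomainType) (m : set R).
Hypotheses (noeth : noetherian R) (loc : local_ring m).
Variables (t s : R).
Hypothesis m_ts : forall c, m c <-> exists p q, c = p * t + q * s.

Lemma param_t : m t.
Proof. by apply/m_ts; exists 1, 0; ring. Qed.

Lemma param_s : m s.
Proof. by apply/m_ts; exists 0, 1; ring. Qed.

(** The maximal ideal of [R/t] is generated by the image of [s]: every element
    is divided by [s] until it becomes a unit, and those for which this never
    stops vanish by [descent_sub]. *)
Lemma mod_parameter a :
  multiples t a \/ exists u k, ~ m u /\ multiples t (a - u * s ^+ k).
Proof.
pose B : set R := [set b | ~ exists u k, ~ m u /\ multiples t (b - u * s ^+ k)].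
have [Ba|/contrapT] := pselect (B a); [left|by right].
apply: (descent_sub noeth loc (multiples_ideal t) param_s _ Ba) => b Bb.
have /m_ts[p [q bE]] : m b.
  apply: contrapT => mb; apply: Bb; exists b, 0%N; split => //.
  by exists 0; ring.
exists q; last by exists p; rewrite bE; ring.
move=> [u [k [mu [c qE]]]]; apply: Bb; exists u, k.+1; split => //.
exists (p + s * c); rewrite bE exprS.
by have -> : q = u * s ^+ k + c * t by [rewrite -qE; ring]; ring.
Qed.

(** Modulo [t] the ideal [P] is generated by an element [p] of [P] of least
    order in [s]; since [t] is not in [P], what is left over is [t] times an
    element of [P]. *)
Lemma prime_principal (P : set R) a0 :
  prime_ideal P -> P a0 -> a0 != 0 -> ~ P t -> exists p, P = multiples p.
Proof.
move=> [iP P1 Pprime] Pa0 a00 Pt; have [P0 PD PM] := iP.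
have Pdivt c : P (c * t) -> P c by move=> /Pprime[].
pose ord k := `[< exists a u, [/\ P a, ~ m u & multiples t (a - u * s ^+ k)] >].
have ex : exists k, ord k.
  apply: contrapT => nex; move/eqP: a00; apply.
  apply: (descent_sub noeth loc (zero_ideal R) param_t _ Pa0) => b Pb.
  case: (mod_parameter b) => [[c bE]|[u [k [mu uk]]]].
    by exists c; [apply: Pdivt; rewrite -bE|rewrite /= bE; ring].
  by case: nex; exists k; apply/asboolP; exists b, u.
case: (ex_minnP ex) => k /asboolP[p [u [Pp mu [c pE]]]] kmin.
exists p; apply/seteqP; split=> [|_ [d ->]]; last exact: PM.
apply: (descent_sub noeth loc (multiples_ideal p) param_t) => b Pb.
suff [c' [d bE]] : exists c' d, b = c' * p + d * t.
  exists d; last by exists c'; rewrite bE; ring.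
  apply: Pdivt; rewrite (_ : d * t = b - c' * p); last by rewrite bE; ring.
  by apply: idealB => //; exact: PM.
case: (mod_parameter b) => [[d bE]|[u' [k' [mu' [d bE]]]]].
  by exists 0, d; rewrite bE; ring.
have kk' : (k <= k')%N by apply: kmin; apply/asboolP; exists b, u'; split => //; exists d.
have [v vu] := unit_of_not_max noeth loc mu.
exists (u' * v * s ^+ (k' - k)), (d - u' * v * s ^+ (k' - k) * c).
have -> : p = u * s ^+ k + c * t by rewrite -pE; ring.
have -> : b = u' * (v * u) * s ^+ k' + d * t by rewrite vu -bE; ring.
by rewrite -(subnK kk') exprD addnK; ring.
Qed.

(** If [s^n] were a multiple of [t], so would be a power of the generator [p]
    of a prime [P] not containing [t]; as [p] does not divide [t], this would
    make [t] a unit. *)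
Lemma parameter_pow_ndvd (P : set R) a0 n :
  prime_ideal P -> P a0 -> a0 != 0 -> ~ P t -> ~ multiples t (s ^+ n).
Proof.
move=> pP Pa0 a00 Pt [c snE].
have [p PE] := prime_principal pP Pa0 a00 Pt.
have [iP P1 Pprime] := pP.
have /m_ts[f [g pE]] : m p.
  apply: (proper_sub_max noeth loc iP P1); rewrite PE; exists 1.
  by rewrite mul1r.
have p0 : p != 0.
  apply: contraNneq a00 => p0; move: Pa0; rewrite PE p0 => -[d ->].
  by rewrite mulr0.
have [d pnE] : multiples t (p ^+ n).
  have: multiples t (p ^+ n - (g * s) ^+ n).
    by rewrite pE subrXX addrK -mulrA mulrC -mulrA mulrC; eexists.
  move=> [d dE]; exists (d + g ^+ n * c).
  by rewrite mulrDl -dE -mulrA -snE exprMn subrK.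
suff [d' dE] : multiples (p ^+ n) d.
  apply: (max_proper loc); rewrite (_ : 1 = d' * t).
    by have [_ _] := max_ideal loc; apply; exact: param_t.
  apply: (mulfI (expf_neq0 n p0)).
  by rewrite mulr1 mulrA [_ * d']mulrC -dE -pnE.
elim: n d pnE {snE} => [|n IH] d pnE; first by exists d; rewrite mulr1.
have : P (d * t) by rewrite -pnE PE exprSr; eexists.
case/Pprime => //; rewrite {1}PE => -[d1 dE].
have [|d2 d1E] := IH d1.
  by apply: (mulIf p0); rewrite -exprSr pnE dE; ring.
by exists d2; rewrite dE d1E exprSr mulrA.
Qed.

(** Orders in [s] add up modulo [t], because no power of [s] vanishes there. *)
Lemma parameter_prime (P : set R) a0 :
  prime_ideal P -> P a0 -> a0 != 0 -> ~ P t -> prime_ideal (multiples t).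
Proof.
move=> pP Pa0 a00 Pt.
split; first exact: multiples_ideal.
  move=> [c tE]; apply: (max_proper loc); rewrite tE.
  by have [_ _] := max_ideal loc; apply; exact: param_t.
move=> a b abt.
case: (mod_parameter a) => [|[u [j [mu [c aE]]]]]; first by left.
case: (mod_parameter b) => [|[v [k [mv [d bE]]]]]; first by right.
case: (@parameter_pow_ndvd P a0 (j + k) pP Pa0 a00 Pt).
have [u' u'P] := unit_of_not_max noeth loc mu.
have [v' v'P] := unit_of_not_max noeth loc mv.
have [f abE] := abt.
exists (u' * v' * (f - u * s ^+ j * d - v * s ^+ k * c - c * d * t)).
have : a * b = f * t by [].
have -> : a = u * s ^+ j + c * t by rewrite -aE; ring.
have -> : b = v * s ^+ k + d * t by rewrite -bE; ring.
move=> ftE; rewrite mulrBr mulrBr mulrBr !mulrBl.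
rewrite -(mulrA _ f t) -ftE exprD.
transitivity ((u' * u) * (v' * v) * s ^+ j * s ^+ k); first by rewrite u'P v'P; ring.
ring.
Qed.

End RegularParameters.

Section Regular.
Variables (R : idomainType) (m : set R) (x y : R).
Hypotheses (regR : regular_local_ring m 2) (m_gen : m = ideal_gen [set x; y]).

Lemma max_xy c : m c <-> exists p q, c = p * x + q * y.
Proof. by rewrite m_gen; exact: ideal_gen2. Qed.

Lemma max_yx c : m c <-> exists p q, c = p * y + q * x.
Proof.
by rewrite max_xy; split=> -[p [q ->]]; exists q, p; rewrite addrC.
Qed.

Definition nonzero_nonmaximal (P : set R) :=
  [/\ prime_ideal P, exists2 p, P p & p != 0 & ~ (P x /\ P y)].

(** The middle term of a chain of three primes is neither zero nor maximal. *)
Lemma nonmaximal_prime_exists : exists P, nonzero_nonmaximal P.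
Proof.
have [noeth loc [[P [pP ltP]] _] _] := regR.
exists (P 1%N); have p1 := pP 1%N isT; split=> //.
- have [_ /existsNP[a /not_implyP[Pa P0a]]] := ltP 0%N isT.
  exists a => //; apply/eqP => a0; apply: P0a.
  by rewrite a0; have [[]] := pP 0%N isT.
- move=> [Px Py]; have [P12 nP] := ltP 1%N isT; apply: nP => a P2a.
  have /max_xy[p [q ->]] : m a.
    have [i2 n2 _] := pP 2 isT.
    exact: (proper_sub_max noeth loc i2 n2).
  by have [[_ D M] _ _] := p1; apply: D; apply: M.
Qed.

(** A parameter outside the prime of [nonmaximal_prime_exists] is prime itself,
    and the prime ideal that it generates does the same service for the other
    parameter. *)
Lemma parameters_prime :
  [/\ prime_ideal (multiples x), prime_ideal (multiples y),
      ~ multiples x y & ~ multiples y x].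
Proof.
have [noeth loc _ _] := regR.
have self (t : R) : multiples t t by exists 1; rewrite mul1r.
have [P [pP [a0 Pa0 a00] nP]] := nonmaximal_prime_exists.
have [iP _ _] := pP.
have [Px|nPx] := pselect (P x).
- have Py : ~ P y by move=> Py; exact: nP.
  have py := parameter_prime noeth loc max_yx pP Pa0 a00 Py.
  have xy : ~ multiples y x.
    exact: (parameter_pow_ndvd noeth loc max_yx (n:=1) pP Pa0 a00 Py).
  have y0 : y != 0 by apply: contra_notN Py => /eqP ->; case: iP.
  split=> //; first exact: (parameter_prime noeth loc max_xy py (self y) y0 xy).
  exact: (parameter_pow_ndvd noeth loc max_xy (n:=1) py (self y) y0 xy).
- have px := parameter_prime noeth loc max_xy pP Pa0 a00 nPx.
  have yx : ~ multiples x y.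
    exact: (parameter_pow_ndvd noeth loc max_xy (n:=1) pP Pa0 a00 nPx).
  have x0 : x != 0 by apply: contra_notN nPx => /eqP ->; case: iP.
  split=> //; first exact: (parameter_prime noeth loc max_yx px (self x) x0 yx).
  exact: (parameter_pow_ndvd noeth loc max_yx (n:=1) px (self x) x0 yx).
Qed.

Lemma x_neq0 : x != 0.
Proof.
have [_ _ _ yx] := parameters_prime.
by apply: contra_notN yx => /eqP ->; exists 0; rewrite mul0r.
Qed.

Lemma y_neq0 : y != 0.
Proof.
have [_ _ xy _] := parameters_prime.
by apply: contra_notN xy => /eqP ->; exists 0; rewrite mul0r.
Qed.

Lemma y_pow_ndvd n : ~ multiples x (y ^+ n).
Proof.
have [[_ x1 px] _ xy _] := parameters_prime.
by elim: n => [|n IH]; rewrite ?expr0 // exprS => /px[].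
Qed.

Lemma x_dvd_of_y_pow n a : multiples x (a * y ^+ n) -> multiples x a.
Proof.
by have [[_ _ px] _ _ _] := parameters_prime; move=> /px[//|/y_pow_ndvd].
Qed.

Lemma prime_nonmaximal_principal P : nonzero_nonmaximal P -> exists p, P = multiples p.
Proof.
move=> [pP [a0 Pa0 a00] nP]; have [noeth loc _ _] := regR.
have [Px|nPx] := pselect (P x).
  by apply: (prime_principal noeth loc max_yx pP Pa0 a00) => Py; apply: nP.
exact: (prime_principal noeth loc max_xy pP Pa0 a00 nPx).
Qed.

End Regular.


(** * Valuations of the fraction field *)

Lemma fraction_quotient (R : idomainType) (z : {fraction R}) :
  exists a b, b != 0 /\ z = FracField.tofrac a / FracField.tofrac b.
Proof.
exists (\n_(repr z)), (\d_(repr z)); have d0 := denom_ratioP (repr z).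
split=> //; have d0' : FracField.tofrac (\d_(repr z)) != 0 by rewrite tofrac_eq0.
apply: (mulIf d0'); rewrite divfK // -{1}[z]reprK.
rewrite !piE; apply/eqmodP; rewrite /= FracField.equivfE /FracField.mulf.
rewrite !numden_Ratio ?mulf_neq0 //; try exact: oner_neq0.
apply/eqP; rewrite (mulrC _ (\n_(repr z))) -mulrA; congr (_ * _).
Qed.

Section Filtration.
Variables (R : idomainType) (F : nat -> set R).
Local Notation io := (@FracField.tofrac R).
Hypotheses (F0 : forall a, F 0%N a) (Fz : forall n, F n 0)
  (FS : forall n a, F n.+1 a -> F n a)
  (FD : forall n a b, F n a -> F n b -> F n (a + b)).
Let order a n := F n a /\ ~ F n.+1 a.
Hypotheses (FM : forall a b n k, order a n -> order b k -> order (a * b) (n + k))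
  (Fsep : forall a : R, a != 0 -> exists n, ~ F n a) (F1 : exists p, order p 1).

Let Fle n k a : (n <= k)%N -> F k a -> F n a.
Proof. by move=> /subnK <-; elim: (k - n)%N => //= i IH /FS /IH. Qed.

Let order_ge a n k : order a n -> F k a <-> (k <= n)%N.
Proof.
move=> [Fn nF]; split=> [Fk|kn]; last exact: Fle Fn.
by rewrite leqNgt; apply/negP => /Fle /(_ Fk).
Qed.

Let order_uniq a n k : order a n -> order a k -> n = k.
Proof.
move=> an ak; apply/eqP; rewrite eqn_leq.
by rewrite -!(rwP andP) -(order_ge _ ak) -(order_ge _ an); case: an; case: ak.
Qed.

Let order_neq0 a n : order a n -> a != 0.
Proof. by move=> [_ nF]; apply/eqP => a0; apply: nF; rewrite a0. Qed.

Let order_exists (a : R) : a != 0 -> exists n, order a n.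
Proof.
move=> /Fsep[k nF].
have ex : exists k, `[< ~ F k a >] by exists k; apply/asboolP.
case: (ex_minnP ex) => -[|n] /asboolP nFn nmin; first by case: nFn.
exists n; split=> //; apply: contrapT => nFa.
by have := nmin n; rewrite ltnn => /(_ (asboolT nFa)).
Qed.

(** A separated filtration whose orders add up on products is the filtration
    by the values of a discrete valuation. *)
Lemma filtration_valuation : exists v : {fraction R} -> int,
  discrete_valuation v /\
  forall a n, a != 0 -> F n a <-> (n%:Z <= v (FracField.tofrac a)).
Proof.
have io0 a : (io a == 0) = (a == 0) by rewrite tofrac_eq0.
have /choice[ord ordP] : forall a : R, exists n, a != 0 -> order a n.
  move=> a; have [->|a0] := eqVneq a 0; first by exists 0%N.
  by have [n an] := order_exists a0; exists n.
have ordM (a b : R) : a != 0 -> b != 0 -> ord (a * b) = (ord a + ord b)%N.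
  move=> a0 b0; apply: (@order_uniq (a * b)); last by apply: FM; exact: ordP.
  by apply: ordP; rewrite mulf_neq0.
have ordD (a b : R) : a != 0 -> b != 0 -> a + b != 0 ->
    (minn (ord a) (ord b) <= ord (a + b)%R)%N.
  move=> a0 b0 ab0; apply/(order_ge _ (ordP _ ab0)).
  apply: FD; first by apply: Fle (geq_minl _ _) _; case: (ordP _ a0).
  by apply: Fle (geq_minr _ _) _; case: (ordP _ b0).
have ord1 : ord 1 = 0%N.
  have := ordM 1 1 (oner_neq0 _) (oner_neq0 _); rewrite mulr1 => /eqP.
  by rewrite -{1}[ord 1]addn0 eqn_add2l => /eqP.
have /choice[v vP] : forall z, exists i : int, forall a b : R, a != 0 -> b != 0 ->
    z = io a / io b -> i = (ord a)%:Z - (ord b)%:Z.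
  move=> z; have [a [b [b0 zE]]] := fraction_quotient z.
  exists ((ord a)%:Z - (ord b)%:Z) => a' b' a'0 b'0 zE'.
  have E : a * b' = a' * b.
    apply/eqP; rewrite -tofrac_eq !rmorphM /=; apply/eqP.
    have: io a / io b = io a' / io b' by rewrite -zE -zE'.
    by move/eqP; rewrite eqr_div ?io0 // => /eqP.
  have a0 : a != 0.
    apply: contraNneq (mulf_neq0 a'0 b0) => a0.
    by rewrite -E a0 mul0r.
  have := congr1 ord E; rewrite !ordM //; lia.
have vE (a b : R) : a != 0 -> b != 0 -> v (io a / io b) = (ord a)%:Z - (ord b)%:Z.
  by move=> a0 b0; exact: vP.
have rep z : z != 0 -> exists a b, [/\ a != 0, b != 0 & z = io a / io b].
  move=> z0; have [a [b [b0 zE]]] := fraction_quotient z.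
  exists a, b; split=> //; apply: contraNneq z0 => a0.
  by rewrite zE a0 rmorph0 mul0r.
have vio (a : R) : a != 0 -> v (io a) = (ord a)%:Z.
  move=> a0; have := vE _ _ a0 (oner_neq0 _).
  by rewrite ord1 rmorph1 divr1 subr0.
exists v; split; last first.
  by move=> a n a0; rewrite vio // lez_nat; apply: order_ge; exact: ordP.
split.
- move=> _ _ /rep[a [b [a0 b0 ->]]] /rep[a' [b' [a'0 b'0 ->]]].
  rewrite mulf_div -!rmorphM /= !vE ?mulf_neq0 // !ordM //; lia.
- move=> _ _ /rep[a [b [a0 b0 ->]]] /rep[a' [b' [a'0 b'0 ->]]].
  rewrite addf_div ?io0 // -!rmorphM -rmorphD /= => s0.
  have s0' : a * b' + a' * b != 0.
    by apply: contraNneq s0 => s0'; rewrite s0' rmorph0 mul0r.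
  rewrite !vE ?mulf_neq0 // !ordM //.
  have := ordD (a * b') (a' * b); rewrite !mulf_neq0 // !ordM // => /(_ isT isT s0').
  move: (ord (_ + _)) (ord a) (ord a') (ord b) (ord b') => s i i' j j'.
  by rewrite geq_min ge_min => /orP[] ?; apply/orP; [left|right]; lia.
- have [p p1] := F1; have p0 := order_neq0 p1.
  have ordX n : ord (p ^+ n) = n.
    elim: n => [|n IH]; first by rewrite expr0 ord1.
    rewrite exprS ordM ?expf_neq0 // IH.
    by rewrite (order_uniq (ordP _ p0) p1).
  case=> n.
  + by exists (io (p ^+ n)); rewrite ?io0 ?expf_neq0 // vio ?expf_neq0 // ordX.
  + exists (io 1 / io (p ^+ n.+1)).
      by rewrite mulf_neq0 ?invr_eq0 ?io0 ?oner_neq0 ?expf_neq0.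
    by rewrite vE ?oner_neq0 ?expf_neq0 // ordX ord1 sub0r NegzE.
Qed.

End Filtration.


Section RegularValuations.
Variables (R : idomainType) (m : set R) (x y : R).
Hypotheses (regR : regular_local_ring m 2) (m_gen : m = ideal_gen [set x; y]).
Local Notation io := (@FracField.tofrac R).

Let noeth : noetherian R. Proof. by case: regR. Qed.
Let loc : local_ring m. Proof. by case: regR. Qed.
Let im : is_ideal m := max_ideal loc.
Let mD a b : m a -> m b -> m (a + b). Proof. by case: im => _ + _; exact. Qed.
Let mM a b : m b -> m (a * b). Proof. by case: im => _ _; exact. Qed.
Let mB a b : m a -> m b -> m (a - b). Proof. exact: idealB im. Qed.
Let mx : m x. Proof. by apply/(max_xy m_gen); exists 1, 0; ring. Qed.
Let my : m y. Proof. by apply/(max_xy m_gen); exists 0, 1; ring. Qed.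

Definition binary_form n (c : nat -> R) : R :=
  \sum_(i < n.+1) c i * x ^+ i * y ^+ (n - i).

(** The [n]-th power of the maximal ideal. *)
Definition adic n : set R := [set f | exists c, f = binary_form n c].

Lemma formS n c : binary_form n.+1 c = c 0%N * y ^+ n.+1 + x * binary_form n (c \o S).
Proof.
rewrite /binary_form big_ord_recl /= expr0 mulr1 subn0; congr (_ + _).
rewrite mulr_sumr; apply: eq_bigr => i _; rewrite /bump add1n subSS exprS /=; ring.
Qed.

Lemma formD n c d : binary_form n c + binary_form n d = binary_form n (fun i => c i + d i).
Proof. by rewrite -big_split; apply: eq_bigr => i _ /=; ring. Qed.

Lemma formM n a c : a * binary_form n c = binary_form n (fun i => a * c i).
Proof. by rewrite mulr_sumr; apply: eq_bigr => i _ /=; ring. Qed.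

Lemma form_head n a : binary_form n (fun i => if i is 0%N then a else 0) = a * y ^+ n.
Proof.
case: n => [|n]; first by rewrite /binary_form big_ord1 !expr0 !mulr1.
by rewrite formS /binary_form big1 ?mulr0 ?addr0 // => i _; rewrite /= !mul0r.
Qed.

(** The parameters satisfy no homogeneous relation except the trivial ones
    over the residue field: the associated graded ring is a polynomial ring. *)
Lemma form_eq0 n c : binary_form n c = 0 -> forall i, (i <= n)%N -> m (c i).
Proof.
elim: n c => [|n IH] c.
  rewrite /binary_form big_ord1 !expr0 !mulr1 => c0 [|//] _; rewrite c0.
  by case: im.
rewrite formS => E.
have [d c0E] : multiples x (c 0%N).
  apply: (x_dvd_of_y_pow regR m_gen (n := n.+1)).
  exists (- binary_form n (c \o S)); apply/eqP; rewrite -subr_eq0 -E; apply/eqP; ring.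
have E' : binary_form n (fun i => (c \o S) i + (if i is 0%N then d * y else 0)) = 0.
  rewrite -formD form_head; apply: (mulfI (x_neq0 regR m_gen)).
  by rewrite mulr0 -E c0E exprS; ring.
move=> [_|i lin]; first by rewrite c0E; exact: mM.
case: i lin => [lin|i lin]; last by have := IH _ E' i.+1 lin; rewrite addr0.
rewrite (_ : c 1%N = (c 1%N + d * y) - d * y); last by ring.
by apply: mB; [exact: (IH _ E' 0%N)|exact: mM].
Qed.

Lemma adicD n f g : adic n f -> adic n g -> adic n (f + g).
Proof. by move=> [c ->] [d ->]; rewrite formD; eexists. Qed.

Lemma adicM n a f : adic n f -> adic n (a * f).
Proof. by move=> [c ->]; rewrite formM; eexists. Qed.

Lemma adic0 n : adic n 0.
Proof. by exists (fun=> 0); rewrite /binary_form big1 // => i _; rewrite !mul0r. Qed.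

Lemma adic_ideal n : is_ideal (adic n).
Proof. by split; [exact: adic0|exact: adicD|exact: adicM]. Qed.

Lemma adic_monomial n i j a : n = (i + j)%N -> adic n (a * x ^+ i * y ^+ j).
Proof.
move=> ->; exists (fun k => (k == i)%:R * a).
have ii : (i < (i + j).+1)%N by rewrite ltnS leq_addr.
rewrite /binary_form (bigD1 (Ordinal ii)) //= eqxx mul1r addKn big1 ?addr0 // => k.
by rewrite -val_eqE /= => /negPf ->; rewrite !mul0r.
Qed.

Lemma adicS n f :
  adic n.+1 f <-> exists c, (forall i, (i <= n)%N -> m (c i)) /\ f = binary_form n c.
Proof.
split=> [[c ->]|[c [mc ->]]].
  exists (fun i => x * (c \o S) i + (if i is 0%N then c 0%N * y else 0)); split.
    move=> [|i] _; last by rewrite addr0 mulrC; exact: mM.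
    by apply: mD; [rewrite mulrC|]; exact: mM.
  by rewrite -formD form_head -formM formS exprS; ring.
apply: ideal_sum (adic_ideal _) _ => i _.
have /(max_xy m_gen)[p [q ->]] : m (c i) by apply: mc; rewrite -ltnS.
rewrite (_ : _ * _ = p * x ^+ i.+1 * y ^+ (n - i) + q * x ^+ i * y ^+ (n - i).+1).
  by have li := ltn_ord i; apply: adicD; apply: adic_monomial; lia.
by rewrite !exprS; ring.
Qed.

Lemma adic_pred n f : adic n.+1 f -> adic n f.
Proof. by move=> /adicS[c [_ ->]]; exists c. Qed.

Lemma adicS_form n c i : (i <= n)%N -> ~ m (c i) -> ~ adic n.+1 (binary_form n c).
Proof.
move=> lin mc /adicS[d [md E]]; apply: mc.
have /form_eq0/(_ i lin) : binary_form n (fun i => c i + (-1) * d i) = 0.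
  by rewrite -formD -formM E; ring.
move=> mcd; rewrite (_ : c i = (c i + -1 * d i) + d i); last by ring.
by apply: mD => //; exact: md.
Qed.

Lemma nadicS_form n c : ~ adic n.+1 (binary_form n c) ->
  exists i, [/\ (i <= n)%N, ~ m (c i) & forall j, (j < i)%N -> m (c j)].
Proof.
move=> nF.
have ex : exists i, (i <= n)%N && `[< ~ m (c i) >].
  apply: contrapT => nex; apply: nF; apply/adicS; exists c; split=> // i lin.
  apply: contrapT => mc; apply: nex; exists i; rewrite lin; exact/asboolP.
case: (ex_minnP ex) => i /andP[lin /asboolP mc] imin; exists i; split=> // j ji.
apply: contrapT => mcj; suff: (i <= j)%N by rewrite leqNgt ji.
by apply: imin; rewrite (leq_trans (ltnW ji) lin); exact/asboolP.
Qed.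

(** Dehomogenization, which turns products of forms into products of
    polynomials. *)
Lemma form_fraction n (c : nat -> R) :
  io (binary_form n c) = io y ^+ n * (map_poly io (\poly_(i < n.+1) c i)).[io x / io y].
Proof.
rewrite (@horner_coef_wide _ n.+1); last first.
  by rewrite (leq_trans (size_poly _ _)) // size_poly.
rewrite rmorph_sum mulr_sumr; apply: eq_bigr => i _ /=.
rewrite coef_map coef_poly ltn_ord !rmorphM !rmorphXn /= expr_div_n.
have y0 : io y != 0 by rewrite tofrac_eq0 (y_neq0 regR m_gen).
have -> : io y ^+ n = io y ^+ (n - i) * io y ^+ i.
  by rewrite -exprD subnK // -ltnS.
have cancel (K : fieldType) (d p q r : K) : r != 0 -> d * p * q = q * r * (d * (p / r)).
  by move=> r0; field.
by apply: cancel; rewrite expf_neq0.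
Qed.

Lemma form_mul n k c d : binary_form n c * binary_form k d = binary_form (n + k)
  (fun i => ((\poly_(i < n.+1) c i) * (\poly_(i < k.+1) d i))`_i).
Proof.
apply/eqP; rewrite -tofrac_eq rmorphM /= !form_fraction; apply/eqP.
set p := poly _ _; set q := poly _ _; set r := poly _ _.
have -> : r = p * q.
  apply/polyP => i; rewrite coef_poly; case: ltnP => // li.
  rewrite nth_default // (leq_trans (size_polyMleq _ _)) //.
  have := size_poly n.+1 c; have := size_poly k.+1 d.
  by rewrite -/p -/q; lia.
by rewrite rmorphM hornerM exprD mulrACA.
Qed.

(** Gauss's lemma for the polynomials of coefficients: the first coefficients
    that are units multiply to a unit coefficient of the product. *)
Lemma adic_order_mul f g n k :
  adic n f /\ ~ adic n.+1 f -> adic k g /\ ~ adic k.+1 g ->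
  adic (n + k) (f * g) /\ ~ adic (n + k).+1 (f * g).
Proof.
move=> [[c ->] /nadicS_form[i [lin mci ci]]] [[d ->] /nadicS_form[j [ljk mdj dj]]].
rewrite form_mul; split; first by eexists.
apply: (@adicS_form _ _ (i + j)); first by rewrite leq_add.
have lij : (i < (i + j).+1)%N by rewrite ltnS leq_addr.
rewrite coefM (bigD1 (Ordinal lij)) //= addKn !coef_poly !ltnS lin ljk.
set s := \sum_(_ < _ | _) _ => mcs.
have ms : m s.
  apply: ideal_sum im _ => l; rewrite -val_eqE /= => li.
  have [{}li|il|/eqP lE] := ltngtP l i; last by rewrite lE in li.
  - by rewrite mulrC; apply: mM; rewrite coef_poly ltnS (leq_trans (ltnW li)) //; exact: ci.
  - apply: mM; rewrite coef_poly ltnS.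
    have lj : (i + j - l < j)%N by have := ltn_ord l; lia.
    by rewrite (leq_trans (ltnW lj) ljk); exact: dj.
have mcd : m (c i * d j) by rewrite -(addrK s (c i * d j)); exact: mB.
have [u uc] := unit_of_not_max noeth loc mci.
by apply: mdj; rewrite -[d j]mul1r -uc -mulrA; exact: mM.
Qed.

Lemma adic_order_x : adic 1 x /\ ~ adic 2 x.
Proof.
split; first by have := @adic_monomial 1 1 0 1 erefl; rewrite mul1r mulr1.
have -> : x = binary_form 1 (fun i => (i == 1)%:R).
  by rewrite /binary_form !big_ord_recl big_ord0 /=; ring.
by apply: (@adicS_form _ _ 1) => //; exact: max_proper loc.
Qed.

Lemma adic_separated a : a != 0 -> exists n, ~ adic n a.
Proof.
move=> a0; apply: contrapT => /forallNP aF; move/eqP: a0; apply.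
pose B : set R := [set b | forall n, adic n b].
apply: (@descent_sub R m noeth loc _ B x (zero_ideal R) mx) => [b Bb|n]; last first.
  exact: contrapT.
have [b' bE] : multiples x b.
  case: (mod_parameter noeth loc (max_xy m_gen) b) => // -[u [k [mu [d uE]]]].
  have [c bE] := Bb k.+1; case: mu.
  have [|d' uE'] := @x_dvd_of_y_pow _ _ _ _ regR m_gen k (u - c 0%N * y).
    exists (binary_form k (c \o S) - d).
    by rewrite 2!mulrBl -uE bE formS exprS; ring.
  by rewrite -(subrK (c 0%N * y) u) uE'; apply: mD; exact: mM.
exists b' => /=; last by rewrite bE; ring.
elim=> [|n IH]; first by exists (fun=> b'); rewrite /binary_form big_ord1 !expr0 !mulr1.
apply: contrapT => nF; have [] := @adic_order_mul x b' 1 n.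
- exact: adic_order_x.
- by [].
- by move=> _; apply; rewrite mulrC -bE.
Qed.

(** Consequently the powers of the maximal ideal are cut out by a valuation,
    which is what makes them integrally closed. *)
Lemma adic_valuation : exists v : {fraction R} -> int,
  discrete_valuation v /\
  forall a n, a != 0 -> adic n a <-> (n%:Z <= v (io a)).
Proof.
apply: filtration_valuation; [|exact: adic0|exact: adic_pred|exact: adicD
  |by move=> a b n k; exact: adic_order_mul|exact: adic_separated|].
- by move=> a; exists (fun=> a); rewrite /binary_form big_ord1 !expr0 !mulr1.
- by exists x; exact: adic_order_x.
Qed.

Lemma prime_valuation p : prime_ideal (multiples p) -> p != 0 ->
  exists v : {fraction R} -> int, discrete_valuation v /\
  forall a n, a != 0 -> multiples (p ^+ n) a <-> (n%:Z <= v (io a)).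
Proof.
move=> pp p0; have [iP p1 pM] := pp.
have mp : m p.
  by apply: (proper_sub_max noeth loc iP p1); exists 1; rewrite mul1r.
have pS n a : ~ multiples (p ^+ n.+1) (a * p ^+ n) <-> ~ multiples p a.
  split=> na [c cE]; apply: na; exists c; first by rewrite cE exprS mulrA.
  by apply: (mulIf (expf_neq0 n p0)); rewrite cE exprS mulrA.
apply: (@filtration_valuation R (fun n => multiples (p ^+ n))).
- by move=> a; exists a; rewrite expr0 mulr1.
- by move=> n; case: (multiples_ideal (p ^+ n)).
- by move=> n _ [c ->]; exists (c * p); rewrite exprS mulrA.
- by move=> n a b; case: (multiples_ideal (p ^+ n)) => _ + _; apply.
- move=> _ _ n k [[a ->] /pS na] [[b ->] /pS nb].
  have -> : a * p ^+ n * (b * p ^+ k) = a * b * p ^+ (n + k).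
    by rewrite exprD; ring.
  by split; [exists (a * b)|apply/pS => /pM[]].
- move=> a a0; apply: contrapT => /forallNP aF; move/eqP: a0; apply.
  pose B : set R := [set b | forall n, multiples (p ^+ n) b].
  apply: (@descent_sub R m noeth loc _ B p (zero_ideal R) mp) => [b Bb|n]; last first.
    exact: contrapT.
  have [b' bE] := Bb 1%N; rewrite expr1 in bE.
  exists b' => /=; last by rewrite bE; ring.
  move=> n; have [c cE] := Bb n.+1; exists c; apply: (mulIf p0).
  by rewrite -bE cE exprS; ring.
- exists p; split; first by exists 1; rewrite mul1r.
  by rewrite -[X in multiples _ X]mul1r -[X in _ * X]expr1; apply/pS.
Qed.

(** If [b] does not divide [a], some ideal [(b : a c)] is prime, and it is not
    maximal because the parameters form a regular sequence.  Its generator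
    defines a valuation for which [a c / b] is not integral. *)
Lemma regular_normal (z : {fraction R}) :
  (forall V : set {fraction R}, discrete_valuation_ring V ->
     range io `<=` V -> V z) ->
  exists a, z = io a.
Proof.
have [a [b [b0 ->]]] := fraction_quotient z => Vz.
have io0 c : c != 0 -> io c != 0 by rewrite tofrac_eq0.
suff [d ->] : multiples b a by exists d; rewrite rmorphM mulfK // io0.
apply: contrapT => nba.
pose colon d : set R := [set c | multiples b (c * d)].
have colon_ideal d : is_ideal (colon d).
  have [m0 iD iM] := multiples_ideal b.
  split=> [|c c'|c c']; rewrite /colon /=.
  - by rewrite mul0r.
  - by rewrite mulrDl; exact: iD.
  - by rewrite -mulrA; exact: iM.
have [||P [d [[f dE] nd PE]] Pmax] := @noetherian_maximal R
    [set P | exists d, [/\ multiples a d, ~ multiples b d & P = colon d]] noeth.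
- by exists (colon a), a; split=> //; exists 1; rewrite mul1r.
- by move=> _ [d [_ _ ->]].
have primeP : prime_ideal P.
  rewrite PE; split; [exact: colon_ideal|by rewrite /colon /= mul1r|].
  move=> c c' cc'; have [cd|ncd] := pselect (colon d c); [by left|right].
  have <- : colon (c * d) = colon d.
    rewrite -PE; apply: Pmax.
      by exists (c * d); split=> //; exists (c * f); rewrite dE mulrA.
    rewrite PE => g gd; rewrite /colon /= mulrCA.
    by case: (multiples_ideal b) => _ _; apply.
  by rewrite /colon /= mulrA (mulrC c').
have Pb : P b by rewrite PE; exists d; rewrite mulrC.
have [p PpE] : exists p, P = multiples p.
  apply: (prime_nonmaximal_principal regR m_gen); split=> //; first by exists b.
  rewrite PE => -[[s sE] [t tE]]; apply: nd.
  have [u sE'] : multiples x s.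
    apply: (x_dvd_of_y_pow regR m_gen (n := 1)); exists t.
    by apply: (mulIf b0); rewrite expr1 mulrAC -sE (mulrAC t) -tE; ring.
  exists u; apply: (mulfI (x_neq0 regR m_gen)); by rewrite sE sE'; ring.
rewrite PpE in primeP.
have p0 : p != 0.
  apply: contraNneq b0 => p0; move: Pb; rewrite PpE p0 => -[c ->].
  by rewrite mulr0.
have [v [dv vP]] := prime_valuation primeP p0.
have a0 : a != 0.
  by apply: contra_notN nba => /eqP ->; exists 0; rewrite mul0r.
have d0 : d != 0.
  by apply: contra_notN nd => /eqP ->; exists 0; rewrite mul0r.
have Vio : range io `<=` [set a | a = 0 \/ 0 <= v a].
  move=> _ [c _ <-]; have [->|c0] := eqVneq c 0; first by left; rewrite rmorph0.
  by right; apply/(vP c 0%N c0); exists c; rewrite mulr1.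
have vab : v (io b) <= v (io a).
  have [|z0|zge] := Vz [set a | a = 0 \/ 0 <= v a] _ Vio.
  - by exists v.
  - by move/eqP: z0; rewrite mulf_eq0 invr_eq0 !(negPf (io0 _ _)).
  - have [vM _ _] := dv; rewrite -(divfK (io0 _ b0) (io a)) vM ?io0 ?lerDr //.
    by rewrite mulf_neq0 ?invr_eq0 ?io0.
have f0 : f != 0 by apply: contraNneq d0 => f0; rewrite dE f0 mul0r.
have vbd : v (io b) <= v (io d).
  apply: (le_trans vab); have [vM _ _] := dv.
  rewrite dE rmorphM vM ?io0 // lerDr.
  by apply/(vP f 0%N f0); exists f; rewrite mulr1.
have vb0 : 0 <= v (io b) by apply/(vP b 0%N b0); exists b; rewrite mulr1.
have [k vbE] : exists k : nat, v (io b) = k%:Z.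
  by case: (v (io b)) vb0 => // k _; exists k.
have [b' bE] : multiples (p ^+ k) b by apply/(vP _ _ b0); rewrite vbE.
have [d' dE'] : multiples (p ^+ k) d by apply/(vP _ _ d0); rewrite -vbE.
have nb' : ~ multiples p b'.
  move=> [c cE]; have : multiples (p ^+ k.+1) b.
    by exists c; rewrite bE cE exprS mulrA.
  by move=> /(vP _ _ b0); rewrite vbE; lia.
have [s sE] : multiples b (p * d).
  suff : P p by rewrite PE.
  by rewrite PpE; exists 1; rewrite mul1r.
have [_ _ pM] := primeP.
have sE' : s * b' = d' * p.
  by apply: (mulIf (expf_neq0 k p0)); rewrite -mulrA -bE -sE dE'; ring.
have [[s' s'E]|//] := pM _ _ (ex_intro _ d' sE' : multiples p (s * b')).
apply: nd; exists s'; apply: (mulfI p0); rewrite sE s'E; ring.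
Qed.

End RegularValuations.


(** * The syzygies of a power of the maximal ideal *)

Section Pairing.
Variables (S : comNzRingType) (x y : S) (n : nat).

(** The relations [y eps_i + x eps_(i+1)] are the syzygies of the monomials of
    degree [n] in [x] and [y] taken with alternating signs, so this form
    identifies the quotient of the free module by them with [(x, y)^n]. *)
Definition pairing (w : 'cV[S]_n.+1) : S :=
  \sum_(i < n.+1) (-1) ^+ i * x ^+ (n - i) * y ^+ i * w i 0.

Definition syzygy (i : nat) : 'cV[S]_n.+1 :=
  y *: eps S n.+1 i + x *: eps S n.+1 i.+1.

Lemma pairingP a u v : pairing (a *: u + v) = a * pairing u + pairing v.
Proof.
rewrite /pairing mulr_sumr -big_split; apply: eq_bigr => i _.
by rewrite !mxE /=; ring.
Qed.

Lemma pairing0 : pairing 0 = 0.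
Proof. by rewrite /pairing big1 // => i _; rewrite mxE mulr0. Qed.

Lemma pairingD u v : pairing (u + v) = pairing u + pairing v.
Proof. by rewrite -{1}[u]scale1r pairingP mul1r. Qed.

Lemma pairingZ a u : pairing (a *: u) = a * pairing u.
Proof. by rewrite -{1}[_ *: u]addr0 pairingP pairing0 addr0. Qed.

Lemma pairingB u v : pairing (u - v) = pairing u - pairing v.
Proof. by rewrite pairingD -scaleN1r pairingZ mulN1r. Qed.

Lemma pairing_sum k (c : 'I_k -> S) (u : 'I_k -> 'cV[S]_n.+1) :
  pairing (\sum_i c i *: u i) = \sum_i c i * pairing (u i).
Proof.
elim/big_rec2: _ => [|i s t _ <-]; first exact: pairing0.
by rewrite pairingP.
Qed.

Lemma pairing_eps i : (i <= n)%N ->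
  pairing (eps S n.+1 i.+1) = (-1) ^+ i * x ^+ (n - i) * y ^+ i.
Proof.
move=> lin; rewrite /pairing (bigD1 (Ordinal (lin : (i < n.+1)%N))) //=.
rewrite mxE eqxx mulr1 big1 ?addr0 // => j; rewrite -val_eqE /= => /negPf ji.
by rewrite mxE eqSS ji mulr0.
Qed.

Lemma pairing_syzygy i : (1 <= i <= n)%N -> pairing (syzygy i) = 0.
Proof.
case: i => // i /andP[_ lin]; rewrite /syzygy pairingD !pairingZ !pairing_eps //.
  by rewrite -(subnSK lin) !exprS; ring.
exact: ltnW.
Qed.

End Pairing.
Arguments pairing {S} x y {n} w.

Lemma pairing_map (R S : comNzRingType) (f : {rmorphism R -> S}) x y n
    (w : 'cV[R]_n.+1) :
  pairing (f x) (f y) (map_mx f w) = f (pairing x y w).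
Proof.
rewrite /pairing rmorph_sum; apply: eq_bigr => i _.
by rewrite !rmorphM !rmorphXn rmorphN1 mxE.
Qed.

Lemma map_eps (R S : comNzRingType) (f : {rmorphism R -> S}) e i :
  map_mx f (eps R e i) = eps S e i.
Proof. by apply/matrixP => j k; rewrite !mxE rmorph_nat. Qed.

Section KernelField.
Variables (K : fieldType) (x y : K) (n : nat) (w : 'cV[K]_n.+1).
Hypotheses (x0 : x != 0) (y0 : y != 0).

Fixpoint syzygy_coef (i : nat) : K :=
  if i is i'.+1 then (w (inord i') 0 - x * syzygy_coef i') / y else 0.
Arguments syzygy_coef : simpl never.

Lemma syzygy_coef0 : syzygy_coef 0 = 0. Proof. by []. Qed.

Lemma syzygy_coefS i :
  syzygy_coef i.+1 = (w (inord i) 0 - x * syzygy_coef i) / y.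
Proof. by []. Qed.

Lemma syzygy_coefE i : (i <= n)%N ->
  w (inord i) 0 = y * syzygy_coef i.+1 + x * syzygy_coef i.
Proof. by move=> lin; rewrite syzygy_coefS mulrC divfK // subrK. Qed.

(** The last coefficient is, up to a unit, the value of the form. *)
Lemma syzygy_coef_last : pairing x y w = 0 -> syzygy_coef n.+1 = 0.
Proof.
suff H k : (k <= n)%N ->
    \sum_(i < k.+1) (-1) ^+ i * x ^+ (k - i) * y ^+ i * w (inord i) 0 =
    (-1) ^+ k * y ^+ k.+1 * syzygy_coef k.+1.
  rewrite /pairing => E; have := H n (leqnn n).
  under eq_bigr do rewrite inord_val.
  rewrite E => /esym/eqP; rewrite mulf_eq0 mulf_eq0 signr_eq0 expf_eq0.
  by rewrite (negPf y0) => /eqP.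
elim: k => [_|k IH lkn].
  by rewrite big_ord1 syzygy_coefE // syzygy_coef0 mulr0 addr0 !expr0 expr1 !mul1r.
rewrite big_ord_recr /= subnn.
have -> : \sum_(i < k.+1) (-1) ^+ i * x ^+ (k.+1 - i) * y ^+ i * w (inord i) 0 =
    x * ((-1) ^+ k * y ^+ k.+1 * syzygy_coef k.+1).
  rewrite -IH; last exact: ltnW.
  rewrite mulr_sumr; apply: eq_bigr => i _.
  by rewrite subSn -1?ltnS // exprS; ring.
rewrite syzygy_coefE //.
by rewrite !exprS expr0; ring.
Qed.

Hypothesis w0 : pairing x y w = 0.

Lemma syzygy_expansion :
  w = \sum_(i < n) syzygy_coef i.+1 *: syzygy x y n i.+1.
Proof.
apply/matrixP => i j; rewrite ord1 {j} summxE.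
rewrite -{1}[i]inord_val syzygy_coefE -1?ltnS //.
under eq_bigr do rewrite !mxE !eqSS mulrDr.
rewrite big_split /=; congr (_ + _).
- have [lin|nin] := ltnP i n.
    rewrite (bigD1 (Ordinal lin)) //= eqxx mulr1 big1 => [|k]; first by rewrite addr0 mulrC.
    by rewrite -val_eqE /= eq_sym => /negPf ->; rewrite !mulr0.
  have -> : i = n :> nat by apply/eqP; rewrite eqn_leq nin -ltnS ltn_ord.
  rewrite syzygy_coef_last // mulr0 big1 // => k _.
  by rewrite eq_sym ltn_eqF ?mulr0 ?ltn_ord.
- case: i => -[|i] /= lin.
    by rewrite syzygy_coef0 mulr0 big1 // => k _; rewrite !mulr0.
  rewrite (bigD1 (Ordinal (lin : (i < n)%N))) //= eqxx mulr1 big1 => [|k]; first by rewrite addr0 mulrC.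
  by rewrite -val_eqE /= eqSS eq_sym => /negPf ->; rewrite !mulr0.
Qed.

Variable A : set K.
Hypotheses (A0 : A 0) (AB : forall a b, A a -> A b -> A (a - b))
  (AM : forall a b, A a -> A b -> A (a * b)).

(** The coefficients can be computed from the first one upwards, dividing by
    [y], or from the last one downwards, dividing by [x]. *)
Lemma syzygy_coef_up : A (x / y) -> (forall i, A (w i 0 / y)) ->
  forall i, A (syzygy_coef i).
Proof.
move=> Axy Aw; elim=> // i IH; rewrite syzygy_coefS mulrBl (mulrC x) -mulrA.
by apply: AB => //; exact: AM.
Qed.

Lemma syzygy_coef_down : A (y / x) -> (forall i, A (w i 0 / x)) ->
  forall i, (i <= n.+1)%N -> A (syzygy_coef i).
Proof.
move=> Ayx Aw i lin; rewrite -(subKn lin); elim: (n.+1 - i)%N => [|k IH].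
  by rewrite subn0 syzygy_coef_last.
have [kn|nk] := leqP k n; last first.
  by rewrite (_ : (n.+1 - k.+1 = 0)%N) //; apply/eqP; rewrite subn_eq0 ltnS ltnW.
have kE : (n.+1 - k = (n.+1 - k.+1).+1)%N by rewrite subnSK.
have := @syzygy_coefE (n.+1 - k.+1) _; rewrite -kE => /(_ (leq_subr _ _)) E.
rewrite (_ : syzygy_coef _ =
    w (inord (n.+1 - k.+1)) 0 / x - syzygy_coef (n.+1 - k) * (y / x)).
  by apply: AB => //; exact: AM.
by rewrite E; field.
Qed.

End KernelField.


(** * Integral closures of a module and of its image in the ring *)

Section ValuationRing.
Variables (K : fieldType) (v : K -> int).
Hypothesis dv : discrete_valuation v.

Lemma valuationM a b : a != 0 -> b != 0 -> v (a * b) = v a + v b.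
Proof. by case: dv => vM _ _; exact: vM. Qed.

Lemma valuation1 : v 1 = 0.
Proof. by have := valuationM (oner_neq0 _) (oner_neq0 _); rewrite mulr1; move: (v 1) => i; lia. Qed.

Lemma valuationN a : a != 0 -> v (- a) = v a.
Proof.
have n1 : -1 != 0 :> K by rewrite oppr_eq0 oner_neq0.
have vN1 : v (-1) = 0.
  by have := valuationM n1 n1; rewrite mulrNN mulr1 valuation1; move: (v _) => i; lia.
by move=> a0; rewrite -mulN1r valuationM // vN1 add0r.
Qed.

Lemma valuationV a : a != 0 -> v a^-1 = - v a.
Proof.
move=> a0; have a0' : a^-1 != 0 by rewrite invr_eq0.
by have := valuationM a0 a0'; rewrite mulfV // valuation1; move: (v _) (v _) => i j; lia.
Qed.

(** The elements of value at least [k] form a module over the valuation ring. *)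
Definition value_ge (k : int) : set K := [set a | a = 0 \/ k <= v a].

Lemma value_geD k a b : value_ge k a -> value_ge k b -> value_ge k (a + b).
Proof.
move=> [->|ka]; first by rewrite add0r.
move=> [->|kb]; first by rewrite addr0; right.
have [->|a0] := eqVneq a 0; first by rewrite add0r; right.
have [->|b0] := eqVneq b 0; first by rewrite addr0; right.
have [ab0|ab0] := eqVneq (a + b) 0; [by left|right].
have [_ /(_ _ _ a0 b0 ab0) vD _] := dv.
by apply: le_trans vD; rewrite le_min ka.
Qed.

Lemma value_geM j k a b : value_ge j a -> value_ge k b -> value_ge (j + k) (a * b).
Proof.
move=> [->|ja]; first by rewrite mul0r; left.
move=> [->|kb]; first by rewrite mulr0; left.
have [->|a0] := eqVneq a 0; first by rewrite mul0r; left.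
have [->|b0] := eqVneq b 0; first by rewrite mulr0; left.
by right; rewrite valuationM // lerD.
Qed.

Lemma value_geN k a : value_ge k a -> value_ge k (- a).
Proof.
move=> [->|ka]; first by rewrite oppr0; left.
by have [->|a0] := eqVneq a 0; [rewrite oppr0; left|right; rewrite valuationN].
Qed.

End ValuationRing.

Section DVR.
Variables (K : fieldType) (V : set K).
Hypothesis dvrV : discrete_valuation_ring V.

Lemma dvrB a b : V a -> V b -> V (a - b).
Proof.
have [v [dv ->]] := dvrV => Va Vb.
by apply: (value_geD dv) => //; exact: (value_geN dv).
Qed.

Lemma dvr0 : V 0.
Proof. by have [v [_ ->]] := dvrV; left. Qed.

Lemma dvrD a b : V a -> V b -> V (a + b).
Proof. by have [v [dv ->]] := dvrV; exact: (value_geD dv). Qed.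

Lemma dvrM a b : V a -> V b -> V (a * b).
Proof. by have [v [dv ->]] := dvrV; exact: (value_geM dv). Qed.

Lemma dvr1 : V 1.
Proof. by have [v [dv ->]] := dvrV; right; rewrite (valuation1 dv). Qed.

Lemma dvr_total a : V a \/ V a^-1.
Proof.
have [v [dv ->]] := dvrV; have [->|a0] := eqVneq a 0; first by left; left.
have [va|va] := leP 0 (v a); first by left; right.
by right; right; rewrite (valuationV dv) // oppr_ge0 ltW.
Qed.

End DVR.

Lemma map_tofrac_inj (R : idomainType) p q :
  injective (map_mx (@FracField.tofrac R) : 'M_(p, q) -> 'M_(p, q)).
Proof.
move=> u v /matrixP uv; apply/matrixP => i j.
by have := uv i j; rewrite !mxE => /eqP; rewrite tofrac_eq => /eqP.
Qed.

Section ClosureTransfer.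
Variables (R : idomainType) (m : set R) (x y : R).
Hypotheses (regR : regular_local_ring m 2) (m_gen : m = ideal_gen [set x; y]).
Variables (n : nat) (M : set 'cV[R]_n.+1).
Hypotheses (M0 : M 0) (MD : forall u v, M u -> M v -> M (u + v))
  (MZ : forall c u, M u -> M (c *: u)).
Hypotheses (Mg : forall i, (1 <= i <= n)%N -> M (syzygy x y n i))
  (Mm : forall u i, M u -> m (u i 0))
  (Mx : exists k, (pairing x y @` M) (x ^+ k)).

Local Notation K := {fraction R}.
Local Notation io := (@FracField.tofrac R).
Let J : set R := pairing x y @` M.
Let MK : set 'cV[K]_n.+1 := map_mx io @` M.
Let JK : set K^o := io @` J.
Let x0 : x != 0 := x_neq0 regR m_gen.
Let y0 : y != 0 := y_neq0 regR m_gen.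
Let iox0 : io x != 0. Proof. by rewrite tofrac_eq0. Qed.
Let ioy0 : io y != 0. Proof. by rewrite tofrac_eq0. Qed.

Lemma map_syzygy i : map_mx io (syzygy x y n i) = syzygy (io x) (io y) n i.
Proof. by rewrite /syzygy map_mxD !map_mxZ !map_eps. Qed.

(** The coefficients of a syzygy lie in [R[1/x]] and in [R[1/y]], hence in [R]
    because [x] does not divide the powers of [y]. *)
Lemma pairing_kernel w : pairing x y w = 0 -> M w.
Proof.
move=> w0; pose z := map_mx io w.
have z0 : pairing (io x) (io y) z = 0 by rewrite pairing_map w0 rmorph0.
pose loc t : set K := [set a | exists k b, a * io t ^+ k = io b].
have locB t a b : loc t a -> loc t b -> loc t (a - b).
  move=> [j [c ac]] [k [d bd]]; exists (j + k)%N, (c * t ^+ k - d * t ^+ j).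
  rewrite rmorphB !rmorphM !rmorphXn /= -ac -bd mulrBl exprD -!mulrA.
  by rewrite [_ ^+ k * _ ^+ j]mulrC.
have locM t a b : loc t a -> loc t b -> loc t (a * b).
  move=> [j [c ac]] [k [d bd]]; exists (j + k)%N, (c * d).
  by rewrite rmorphM /= -ac -bd exprD mulrACA.
have loc0 t : loc t 0 by exists 0%N, 0; rewrite mul0r rmorph0.
have locV t c : io t != 0 -> loc t (io c / io t).
  by move=> t0; exists 1%N, c; rewrite expr1 divfK.
pose d := syzygy_coef (io x) (io y) z.
have [f fP] : exists f, forall i : 'I_n, d i.+1 = io (f i).
  suff /choice[f fP] : forall i : 'I_n, exists c, d i.+1 = io c by exists f.
  move=> i.
  have [j [b bE]] : loc y (d i.+1).
    apply: syzygy_coef_up; [exact: loc0|exact: locB|exact: locM|exact: locV|].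
    by move=> k; rewrite mxE; exact: locV.
  have [k [c cE]] : loc x (d i.+1).
    apply: (syzygy_coef_down iox0 ioy0 z0);
      [exact: loc0|exact: locB|exact: locM|exact: locV| |].
      by move=> l; rewrite mxE; exact: locV.
    by rewrite ltnS ltnW.
  elim: k c cE => [|k IH] c cE; first by exists c; rewrite -cE mulr1.
  have [c' c'E] : multiples x c.
    apply: (x_dvd_of_y_pow regR m_gen (n := j)); exists (b * x ^+ k).
    apply/eqP; rewrite -tofrac_eq; apply/eqP.
    rewrite !rmorphM !rmorphXn /= -cE -bE exprSr.
    by rewrite mulrAC -!mulrA.
  by apply: (IH c'); apply: (mulIf iox0); rewrite -mulrA -exprSr cE c'E rmorphM.
have -> : w = \sum_(i < n) f i *: syzygy x y n i.+1.
  apply: map_tofrac_inj; rewrite -/z (syzygy_expansion ioy0 z0) map_mx_sum.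
  by apply: eq_bigr => i _; rewrite map_mxZ map_syzygy; congr (_ *: _); exact: fP.
by elim/big_ind: _ => // i _; apply/MZ/Mg; rewrite /= ltn_ord.
Qed.

Lemma pairing_preimage w : J (pairing x y w) -> M w.
Proof.
move=> [u Mu uw]; rewrite -(subrK u w); apply: MD => //.
by apply: pairing_kernel; rewrite pairingB uw subrr.
Qed.

Lemma form_pairing (w : 'cV[R]_n.+1) :
  pairing x y w = binary_form x y n (fun i => (-1) ^+ (n - i) * w (inord (n - i)) 0).
Proof.
rewrite /pairing /binary_form (reindex_inj rev_ord_inj) /=; apply: eq_bigr => i _.
rewrite subSS subKn -1?ltnS // (_ : inord (n - i) = rev_ord i); first by ring.
by apply: val_inj; rewrite /= inordK ?subSS // ltnS leq_subr.
Qed.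

Lemma adic_pairing f : adic x y n.+1 f <->
  exists w : 'cV[R]_n.+1, (forall i, m (w i 0)) /\ f = pairing x y w.
Proof.
have [noeth loc _ _] := regR; have [_ _ mM] := max_ideal loc.
split=> [/(adicS regR m_gen)[c [mc ->]]|[w [mw ->]]]; last first.
  apply/(adicS regR m_gen); rewrite form_pairing; eexists; split; last by [].
  by move=> i _; exact: mM.
exists (\col_i ((-1) ^+ i * c (n - i)%N)); split=> [i|].
  by rewrite mxE; apply: mM; apply: mc; exact: leq_subr.
rewrite form_pairing; apply: eq_bigr => i _; rewrite mxE.
have ni : (n - i < n.+1)%N by rewrite ltnS leq_subr.
by rewrite inordK // subKn -1?ltnS // mulrA -exprMn mulrNN mulr1 expr1n mul1r.
Qed.

(** In a valuation ring [V] one of [x], [y] divides the other, say [t] is the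
    smaller one.  The kernel of the form on [V^(n+1)], multiplied by [t], is
    spanned by the syzygies; so the condition on the coordinates of [w], each
    of which is a multiple of [t], removes the difference between the kernel
    and that span. *)
Lemma pairing_preimage_valuation V (w : 'cV[R]_n.+1) :
  discrete_valuation_ring V -> range io `<=` V -> (forall i, m (w i 0)) ->
  span_over V JK (io (pairing x y w)) -> span_over V MK (map_mx io w).
Proof.
move=> dV RV mw [k [c [u [Vc Ju wE]]]].
have /choice[f fP] : forall i, exists v, M v /\ u i = io (pairing x y v).
  by move=> i; have [_ [v Mv <-] <-] := Ju i; exists v.
pose s : 'cV[K]_n.+1 := \sum_i c i *: map_mx io (f i).
have spans : span_over V MK s.
  exists k, c, (fun i => map_mx io (f i)); split=> // i.
  by exists (f i) => //; exact: (fP i).1.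
pose z := map_mx io w - s.
have z0 : pairing (io x) (io y) z = 0.
  rewrite pairingB pairing_map pairing_sum; apply/eqP; rewrite subr_eq0.
  by apply/eqP; apply: (etrans wE); apply: eq_bigr => i _; rewrite pairing_map (fP i).2.
have -> : map_mx io w = z + s by rewrite subrK.
apply: span_overD => //.
have Vio a : V (io a) by apply: RV; exists a.
have zt t : (forall a, m a -> V (io a / t)) -> forall i, V (z i 0 / t).
  move=> Vt i; rewrite mxE [(- s) i 0]mxE mulrBl; apply: (dvrB dV).
    by rewrite mxE; exact: Vt.
  rewrite summxE mulr_suml; elim/big_ind: _ => [|a b Va Vb|j _].
  - exact: dvr0 dV.
  - exact: (dvrD dV).
  - rewrite !mxE -mulrA; apply: (dvrM dV) => //; apply: Vt.
    by apply: Mm; exact: (fP j).1.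
have maxV t (Vx : V (io x / t)) (Vy : V (io y / t)) a : m a -> V (io a / t).
  move=> /(max_xy m_gen)[p [q ->]]; rewrite rmorphD !rmorphM /= mulrDl -!mulrA.
  by apply: (dvrD dV); exact: (dvrM dV).
rewrite (syzygy_expansion ioy0 z0).
suff Vd (i : 'I_n) : V (syzygy_coef (io x) (io y) z i.+1).
  elim/big_ind: _ => [|a b|i _]; [exact: span_over0|exact: span_overD|].
  apply: span_overM => //; exists (syzygy x y n i.+1); last exact: map_syzygy.
  by apply: Mg; rewrite /= ltn_ord.
have divt t : t != 0 -> V (t / t) by move=> t0; rewrite mulfV //; exact: dvr1 dV.
have [Vxy|] := dvr_total dV (io x / io y).
- apply: (@syzygy_coef_up _ _ _ _ _ V); [exact: dvr0 dV|exact: dvrB dV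
    |exact: dvrM dV|exact: Vxy|].
  by apply: zt; apply: maxV => //; exact: divt.
- rewrite invf_div => Vyx.
  apply: (@syzygy_coef_down _ _ _ _ _ iox0 ioy0 z0 V); [exact: dvr0 dV
    |exact: dvrB dV|exact: dvrM dV|exact: Vyx| |by rewrite ltnS ltnW].
  by apply: zt; apply: maxV => //; exact: divt.
Qed.

Lemma span_pairing V (w : 'cV[K]_n.+1) :
  span_over V MK w -> span_over V JK (pairing (io x) (io y) w).
Proof.
move=> [k [c [u [Vc Mu ->]]]].
exists k, c, (fun i => pairing (io x) (io y) (u i)); split=> //; last first.
  exact: pairing_sum.
move=> i; have [v Mv <-] := Mu i.
by exists (pairing x y v); [exists v|rewrite pairing_map].
Qed.

Lemma JK_adic V f v : discrete_valuation v -> 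
  (forall a k, a != 0 -> adic x y k a <-> (k%:Z <= v (io a))) ->
  V = [set a | a = 0 \/ 0 <= v a] ->
  span_over V JK f -> value_ge v n.+1%:Z f.
Proof.
move=> dv vP VE; apply: span_over_min => [|a b|a u]; first by left.
- exact: (value_geD dv).
- rewrite VE => Va [_ [w Mw <-] <-]; rewrite -[X in value_ge _ X]add0r.
  apply: (value_geM dv) => //.
  have [->|p0] := eqVneq (pairing x y w) 0; first by left; rewrite rmorph0.
  right; apply/vP => //; apply/adic_pairing; exists w; split=> // i.
  exact: Mm.
Qed.

(** The closure of [J] stays in the power [n + 1] of the maximal ideal, which
    is closed; its elements are the values of the form at vectors with
    coordinates in the maximal ideal, and for those the two closure conditions
    agree. *)
Lemma closed_transfer :
  integrally_closed_ideal J <-> integrally_closed_module M.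
Proof.
have MKcl : MK `<=` integral_closure MK.
  move=> f Mf; split=> [|V dV _]; first exact: span_gen.
  by apply: span_over_gen => //; exact: dvr1 dV.
have JKcl : JK `<=` integral_closure JK.
  move=> f Jf; split=> [|V dV _]; first exact: (@span_gen _ K^o).
  by apply: (@span_over_gen _ K^o) => //; exact: dvr1 dV.
split=> [Jcl|Mcl]; apply/seteqP; split=> // f [spf clf].
- have /choice[w wP] : forall i, exists a, f i 0 = io a.
    move=> i; apply: (regular_normal regR m_gen) => V dV RV.
    have := clf V dV RV; move: f {spf clf}.
    apply: span_over_min => [|u v Vu Vv|a _ Va [u Mu <-]].
    + by rewrite /= mxE; exact: dvr0 dV.
    + by rewrite /= mxE; exact: (dvrD dV).
    + by rewrite /= !mxE; apply: (dvrM dV) => //; apply: RV; exists (u i 0).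
  have fE : f = map_mx io (\col_i w i).
    by apply/matrixP => i j; rewrite ord1 !mxE wP.
  exists (\col_i w i) => //; apply: pairing_preimage.
  have [a Ja] : JK (pairing (io x) (io y) f).
    rewrite -[JK]Jcl; split; first exact: span_pairing.
    by move=> V dV RV; apply: span_pairing; exact: clf.
  rewrite fE pairing_map => /eqP; rewrite tofrac_eq => /eqP <-.
  exact: Ja.
- have [a fE] : exists a, f = io a.
    apply: (regular_normal regR m_gen) => V dV RV.
    have := clf V dV RV; apply: (@span_over_min _ K^o).
    + exact: dvr0 dV.
    + by move=> u v Vu Vv; exact: (dvrD dV).
    + by move=> b _ Vb [c _ <-]; apply: (dvrM dV) => //; apply: RV; exists c.
  have [v [dv vP]] := adic_valuation regR m_gen.
  have : value_ge v n.+1%:Z f.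
    apply: (JK_adic dv vP erefl); apply: clf; first by exists v.
    move=> _ [c _ <-]; have [->|c0] := eqVneq c 0; first by left; rewrite rmorph0.
    by right; apply/(vP c 0%N c0); exists (fun=> c); rewrite /binary_form big_ord1 !expr0 !mulr1.
  move=> fge.
  have /adic_pairing[w [mw aE]] : adic x y n.+1 a.
    have [->|a0] := eqVneq a 0; first exact: adic0.
    case: fge => [/eqP|]; first by rewrite fE tofrac_eq0 (negPf a0).
    by rewrite fE => /vP; apply.
  suff Mw : M w by exists a => //; exists w.
  have [u Mu /eqP] : MK (map_mx io w).
    rewrite -[MK]Mcl; split; last first.
      move=> V dV RV; apply: pairing_preimage_valuation => //.
      by rewrite -aE -fE; exact: clf.
    have [k [u Mu uE]] := Mx.
    have Mxw : M (x ^+ k *: w).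
      apply: pairing_preimage; exists (pairing x y w *: u); first exact: MZ.
      by rewrite !pairingZ uE mulrC.
    have -> : map_mx io w = (io (x ^+ k))^-1 *: map_mx io (x ^+ k *: w).
      by rewrite map_mxZ scalerA mulVf ?scale1r // rmorphXn expf_neq0.
    by apply: span_overM => //; exists (x ^+ k *: w).
  move/eqP => E; suff -> : w = u by [].
  exact: map_tofrac_inj.
Qed.

End ClosureTransfer.


(** * The Fitting ideal of the cokernel in the double dual *)

Lemma scale_addE (R : comNzRingType) (V : Type) a (f g : V -> R^o) u :
  (a *: f + g) u = a *: f u + g u.
Proof. by []. Qed.

Lemma linear_on_sum (R : comNzRingType) (V : lmodType R) (N : set V)
    (phi : V -> R^o) k (c : 'I_k -> R) (u : 'I_k -> V) :
  N 0 -> (forall u v, N u -> N v -> N (u + v)) ->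
  (forall a u, N u -> N (a *: u)) ->
  (forall a u v, N u -> N v -> phi (a *: u + v) = a *: phi u + phi v) ->
  (forall i, N (u i)) ->
  phi (\sum_i c i *: u i) = \sum_i c i * phi (u i).
Proof.
move=> N0 ND NZ lin Nu.
have phi0 : phi 0 = 0.
  have := lin 1 0 0 N0 N0; rewrite scale1r addr0 scale1r -{1}[phi 0]addr0.
  by move/addrI => <-.
suff [] : N (\sum_i c i *: u i) /\ phi (\sum_i c i *: u i) = \sum_i c i * phi (u i).
  by [].
elim/big_rec2: _ => [|i s t _ [Nt <-]]; first by split.
by split; [apply: ND => //; exact: NZ|rewrite lin].
Qed.

(** Expanding a determinant along its first columns leaves minors all of whose
    rows are taken from the last columns. *)
Lemma det_last_columns (R : comNzRingType) (e : nat) (P : set 'rV[R]_e) (J : set R) :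
  is_ideal J -> (forall W : 'M[R]_e, (forall i, P (row i W)) -> J (\det W)) ->
  forall k (Z : 'M[R]_(k + e)),
    (forall i, P (\row_j Z i (rshift k j))) -> J (\det Z).
Proof.
move=> iJ detJ; elim=> [|k IH] Z PZ.
  apply: detJ => i; have -> // : row i Z = \row_j Z i (rshift 0 j).
  by apply/rowP => j; rewrite !mxE; congr (Z _ _); apply: val_inj.
rewrite (expand_det_col (Z : 'M_((k + e).+1)) ord0).
apply: ideal_sum => // i _; have [_ _ JM] := iJ; apply: (JM); apply: JM.
apply: IH => l; have := PZ (lift i l); congr P.
by apply/rowP => j; rewrite !mxE; congr (Z _ _); apply: val_inj.
Qed.

(** The matrix whose rows are [w] and the syzygies has determinant
    [pairing x y w]: it maps the column of signed monomials to a multiple of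
    the first basis vector, and its first minor is triangular. *)
Lemma det_syzygies (R : idomainType) (x y : R) n (w : 'cV[R]_n.+1) : x != 0 ->
  \det (\matrix_(i < n.+1, j < n.+1)
    if i == 0%N :> nat then w j 0 else syzygy x y n i j 0) = pairing x y w.
Proof.
move=> x0; set A := \matrix_(_, _) _.
pose p : 'cV[R]_n.+1 := \col_i ((-1) ^+ i * x ^+ (n - i) * y ^+ i).
have pairE v : pairing x y v = \sum_i v i 0 * p i 0.
  by rewrite /pairing; apply: eq_bigr => i _; rewrite [p _ _]mxE mulrC.
have Ap : A *m p = pairing x y w *: delta_mx 0 0.
  apply/colP => i; rewrite !mxE eqxx andbT.
  have [->|i0] := eqVneq i ord0.
    by rewrite mulr1 pairE; apply: eq_bigr => j _; rewrite [A _ _]mxE.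
  rewrite mulr0; transitivity (pairing x y (syzygy x y n i)).
    rewrite pairE; apply: eq_bigr => j _; rewrite [A _ _]mxE.
    by rewrite -val_eqE /= in i0; rewrite (negPf i0).
  by apply: pairing_syzygy; rewrite -(ltnS i n) ltn_ord andbT lt0n.
have minor : \adj A 0 0 = x ^+ n.
  rewrite mxE /cofactor expr0 mul1r det_trig.
    under eq_bigr => i _.
      rewrite !mxE /= /bump /= !add1n eqxx eqSS (gtn_eqF (ltnSn i)) mulr0 add0r mulr1.
      over.
    by rewrite prodr_const card_ord.
  apply/is_trig_mxP => i j ij; rewrite !mxE /= /bump /= !add1n !eqSS.
  by rewrite (gtn_eqF ij) (gtn_eqF (leqW ij)) !mulr0 addr0.
apply: (mulIf (expf_neq0 n x0)).
have := congr1 (fun B => (\adj A *m B) 0 0) Ap.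
rewrite /= mulmxA mul_adj_mx mul_scalar_mx -scalemxAr -colE !mxE.
rewrite !expr0 mul1r subn0 mulr1 => ->.
by rewrite -minor mxE.
Qed.

Section DoubleDual.
Variables (R : idomainType) (m : set R) (x y : R).
Hypotheses (regR : regular_local_ring m 2) (m_gen : m = ideal_gen [set x; y]).
Variables (n : nat) (M : set 'cV[R]_n.+1).
Hypotheses (M0 : M 0) (MD : forall u v, M u -> M v -> M (u + v))
  (MZ : forall c u, M u -> M (c *: u)).
Variables (A B : nat).
Hypotheses (Mx : forall w, M (x ^+ A *: w)) (My : forall w, M (y ^+ B *: w)).
Local Notation F := 'cV[R]_n.+1.
Let x0 : x != 0 := x_neq0 regR m_gen.

Definition dot (c u : F) : R := \sum_i c i 0 * u i 0.

Lemma dotP a u v c : dot c (a *: u + v) = a * dot c u + dot c v.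
Proof.
by rewrite /dot mulr_sumr -big_split; apply: eq_bigr => i _; rewrite !mxE /=; ring.
Qed.

Lemma dotC c u : dot c u = dot u c.
Proof. by apply: eq_bigr => i _; rewrite mulrC. Qed.

Lemma dot_delta c i : dot c (delta_mx i 0) = c i 0.
Proof.
rewrite /dot (bigD1 i) //= mxE !eqxx mulr1 big1 ?addr0 // => j /negPf ji.
by rewrite mxE ji mulr0.
Qed.

Lemma vector_sum (w : F) : w = \sum_i w i 0 *: delta_mx i 0.
Proof.
rewrite {1}[w]matrix_sum_delta; apply: eq_bigr => i _.
by rewrite big_ord1.
Qed.

Lemma x_pow_dvd_of_y_pow k j a :
  multiples (x ^+ k) (a * y ^+ j) -> multiples (x ^+ k) a.
Proof.
elim: k a => [|k IH] a [c cE]; first by exists a; rewrite mulr1.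
have [|d dE] := IH a; first by exists (c * x); rewrite cE exprS; ring.
have [|f fE] := @x_dvd_of_y_pow _ _ _ _ regR m_gen j d.
  exists c; apply: (mulIf (expf_neq0 k x0)).
  by rewrite mulrAC -dE cE exprS mulrA.
by exists f; rewrite dE fE exprS mulrA.
Qed.

(** The values of a form on [x^A eps_i] and [y^B eps_i] are in the ratio of
    [x^A] to [y^B], so they are these powers times one scalar. *)
Lemma dual_dot phi : dual M phi -> exists c, forall u, M u -> phi u = dot c u.
Proof.
move=> [lin _].
have phiZ a u : M u -> phi (a *: u) = a * phi u.
  move=> Mu; have := @linear_on_sum _ _ M phi 1 (fun=> a) (fun=> u) M0 MD MZ lin.
  by rewrite !big_ord1; apply.
have /choice[c cP] : forall i, exists c, phi (x ^+ A *: delta_mx i 0) = c * x ^+ A.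
  move=> i; apply: (@x_pow_dvd_of_y_pow A B).
  exists (phi (y ^+ B *: delta_mx i 0)).
  by rewrite mulrC -phiZ // scalerA mulrC -scalerA phiZ // mulrC.
exists (\col_i c i) => u Mu; apply: (mulIf (expf_neq0 A x0)).
rewrite mulrC -phiZ //.
have -> : x ^+ A *: u = \sum_i u i 0 *: (x ^+ A *: delta_mx i 0).
  rewrite {1}[u]vector_sum scaler_sumr; apply: eq_bigr => i _.
  by rewrite !scalerA mulrC.
rewrite (linear_on_sum (N := M)) // mulr_suml; apply: eq_bigr => i _.
by rewrite cP mxE; ring.
Qed.

Lemma dot_inj c d : (forall u, M u -> dot c u = dot d u) -> c = d.
Proof.
move=> cd; apply/colP => i; apply: (mulfI (expf_neq0 A x0)).
have := cd _ (Mx (delta_mx i 0)).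
have dotZ b u f : dot f (b *: u) = b * dot f u.
  by rewrite -[b *: u]addr0 dotP /dot [X in _ + X]big1 ?addr0 // => j _; rewrite mxE mulr0.
by rewrite !dotZ !dot_delta.
Qed.

Lemma dual_closed a phi psi : dual M phi -> dual M psi -> dual M (a *: phi + psi).
Proof.
move=> [lphi zphi] [lpsi zpsi]; split=> [b u v Mu Mv|u Mu].
  rewrite !scale_addE lphi // lpsi // !scalerDr !scalerA mulrC.
  by rewrite addrACA.
by rewrite scale_addE zphi // zpsi // scaler0 addr0.
Qed.

Lemma dual0 : dual M 0.
Proof. by split=> [a u v _ _|//]; rewrite scaler0 addr0. Qed.

Definition dual_coordinate (i : 'I_n.+1) : F -> R^o :=
  fun u => if `[< M u >] then u i 0 else 0.

Lemma dual_coordinateE i u : M u -> dual_coordinate i u = u i 0.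
Proof. by move=> Mu; rewrite /dual_coordinate asboolT. Qed.

Lemma dual_coordinateP i : dual M (dual_coordinate i).
Proof.
split=> [a u v Mu Mv|u nMu]; last by rewrite /dual_coordinate asboolF.
by rewrite !dual_coordinateE ?mxE //; apply: MD => //; exact: MZ.
Qed.

(** Both duals are free of rank [n + 1], and evaluation extends to an
    isomorphism from the free module onto the double dual. *)
Lemma double_dual : exists T : F -> (F -> R^o) -> R^o,
  [/\ forall a u v, T (a *: u + v) = a *: T u + T v, injective T,
      range T = dual (dual M) & forall u, M u -> T u = eval_at M u].
Proof.
have /choice[L LP] : forall phi, exists c,
    dual M phi -> forall u, M u -> phi u = dot c u.
  move=> phi; have [/dual_dot[c cP]|] := pselect (dual M phi); first by exists c.
  by exists 0.
pose T (w : F) : (F -> R^o) -> R^o :=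
  fun phi => if `[< dual M phi >] then dot (L phi) w else 0.
have TE w phi : dual M phi -> T w phi = dot (L phi) w.
  by move=> dphi; rewrite /T asboolT.
have LD a phi psi : dual M phi -> dual M psi ->
    L (a *: phi + psi) = a *: L phi + L psi.
  move=> dphi dpsi; apply: dot_inj => u Mu.
  rewrite -LP //; last exact: dual_closed.
  by rewrite dotC dotP !(dotC u) -!LP.
have Lcoord i : L (dual_coordinate i) = delta_mx i 0.
  apply: dot_inj => u Mu; rewrite -LP //; last exact: dual_coordinateP.
  by rewrite dual_coordinateE // dotC dot_delta.
have dualM : forall a phi, dual M phi -> dual M (a *: phi).
  by move=> a phi dphi; rewrite -[_ *: _]addr0; apply: dual_closed => //; exact: dual0.
have dualD phi psi : dual M phi -> dual M psi -> dual M (phi + psi).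
  by rewrite -{2}[phi]scale1r; exact: dual_closed.
exists T; split.
- move=> a u v; apply/funext => phi; rewrite scale_addE /T.
  by case: asboolP => dphi; [exact: dotP|rewrite scaler0 addr0].
- move=> u v uv; apply/colP => i.
  have := congr1 (fun f => f (dual_coordinate i)) uv.
  by rewrite !TE ?Lcoord ?(dotC (delta_mx _ _)) ?dot_delta //; exact: dual_coordinateP.
- apply/seteqP; split=> [_ [w _ <-]|psi [lin zpsi]].
    split=> [a phi psi dphi dpsi|phi nphi]; last by rewrite /T asboolF.
    rewrite !TE //; last exact: dual_closed.
    by rewrite LD // dotC dotP !(dotC w).
  exists (\col_i psi (dual_coordinate i)) => //; apply/funext => phi.
  have [dphi|nphi] := pselect (dual M phi); last by rewrite zpsi // /T asboolF.
  have phiE : phi = \sum_i L phi i 0 *: dual_coordinate i.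
    apply/funext => u; rewrite fct_sumE; have [Mu|nMu] := pselect (M u).
      by rewrite LP //; apply: eq_bigr => i _; rewrite -[RHS]/(_ * _) dual_coordinateE.
    have [_ ->//] := dphi; rewrite big1 // => i _.
    by rewrite -[LHS]/(_ * _) (dual_coordinateP i).2 // mulr0.
  rewrite TE // [in RHS]phiE (linear_on_sum (N := dual M)) //.
  + by apply: eq_bigr => i _; rewrite mxE.
  + exact: dual0.
  + exact: dual_coordinateP.
- move=> u Mu; apply/funext => phi; rewrite /T /eval_at.
  by case: asboolP => // dphi; rewrite -(LP _ dphi _ Mu).
Qed.

Hypotheses (Mg : forall i, (1 <= i <= n)%N -> M (syzygy x y n i))
  (Mdet : forall W : 'M[R]_n.+1, (forall i, M (row i W)^T) ->
    (pairing x y @` M) (\det W)).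

Lemma pairing_image_ideal : is_ideal (pairing x y @` M).
Proof.
split; first by exists 0 => //; exact: pairing0.
- by move=> _ _ [u Mu <-] [v Mv <-]; exists (u + v); [exact: MD|exact: pairingD].
- by move=> c _ [u Mu <-]; exists (c *: u); [exact: MZ|exact: pairingZ].
Qed.

(** A presentation of the cokernel by other generators is compared with the one
    by the standard basis through the block matrix of both sets of generators
    and the relations between them. *)
Lemma ideal_of_module_pairing : ideal_of_module M = pairing x y @` M.
Proof.
have [T [Tlin Tinj Trange TM]] := double_dual.
have T0 : T 0 = 0.
  have := Tlin 1 0 0; rewrite !scale1r addr0 -{1}[T 0]addr0.
  by move/addrI => <-.
have TD u v : T (u + v) = T u + T v by rewrite -{1}[u]scale1r Tlin scale1r.
have TZ a u : T (a *: u) = a *: T u by rewrite -[a *: u]addr0 Tlin T0 addr0.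
have TB u v : T (u - v) = T u - T v by rewrite TD -scaleN1r TZ scaleN1r.
have Tsum k (c : 'I_k -> R) (u : 'I_k -> F) :
    T (\sum_i c i *: u i) = \sum_i c i *: T (u i).
  by elim/big_rec2: _ => // i s t _ <-; rewrite Tlin.
rewrite /ideal_of_module /fitting0; apply/seteqP; split.
- apply: ideal_gen_min; first exact: pairing_image_ideal.
  move=> _ [k [v [C [NE relC ->]]]].
  have /choice[f fP] : forall i, exists w, T w = v i.
    move=> i; have : dual (dual M) (v i).
      by rewrite NE; apply: span_gen; left; exists i.
    by rewrite -Trange => -[w _ wE]; exists w.
  have relM (c : 'I_k -> R) w :
      (eval_at M @` M) (T w - \sum_j c j *: v j) -> M (w - \sum_j c j *: f j).
    move=> [u Mu]; rewrite -TM // => uE; suff -> : w - \sum_j c j *: f j = u by [].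
    apply: Tinj; rewrite uE TB Tsum.
    by congr (_ - _); apply: eq_bigr => j _; rewrite fP.
  have /choice[D DP] : forall i : 'I_n.+1, exists d : 'I_k -> R,
      M (delta_mx i 0 - \sum_j d j *: f j).
    move=> i.
    suff [d dP] : exists d : 'I_k -> R,
        (eval_at M @` M) (T (delta_mx i 0) - \sum_j d j *: v j).
      by exists d; exact: relM.
    have : dual (dual M) (T (delta_mx i 0)) by rewrite -Trange; eexists.
    rewrite NE; move: (T _).
    apply: (@span_over_min _ _ _ _ [set psi | exists d : 'I_k -> R,
      (eval_at M @` M) (psi - \sum_j d j *: v j)]) => [|u1 u2|c u _].
    + exists (fun=> 0); rewrite big1 ?subr0 => [|j _]; last by rewrite scale0r.
      by exists 0; rewrite // -TM.
    + move=> [d1 [w1 Mw1 E1]] [d2 [w2 Mw2 E2]]; exists (fun j => d1 j + d2 j).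
      exists (w1 + w2); first exact: MD.
      rewrite -TM; last exact: MD.
      rewrite TD !TM // E1 E2 addrACA -opprD -big_split.
      by congr (_ - _); apply: eq_bigr => j _; rewrite scalerDl.
    + move=> [[j _ <-]|[w Mw <-]].
        exists (fun l => (l == j)%:R * c); exists 0 => //.
        rewrite (bigD1 j) //= eqxx mul1r big1 ?addr0 ?subrr -?TM // => l /negPf ->.
        by rewrite mul0r scale0r.
      exists (fun=> 0); rewrite big1 ?subr0 => [|j _]; last by rewrite scale0r.
      exists (c *: w); first exact: MZ.
      by rewrite -!TM ?TZ //; exact: MZ.
  pose E : 'M[R]_(k, n.+1) := \matrix_(i, j) f i j 0.
  pose G : 'M[R]_(n.+1, k) := \matrix_(i, j) D i j.
  have rowE p (H : 'M[R]_(p, k)) i : (row i (H *m E))^T = \sum_j H i j *: f j.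
    apply/colP => l; rewrite !mxE summxE; apply: eq_bigr => j _.
    by rewrite !mxE.
  have -> : \det C = \det (block_mx C (C *m E) (- G) (1%:M - G *m E)).
    have -> : block_mx C (C *m E) (- G) (1%:M - G *m E) =
        block_mx C 0 (- G) 1%:M *m block_mx 1%:M E 0 1%:M.
      rewrite mulmx_block !mulmx1 !mulmx0 !addr0 mulNmx.
      by rewrite [- _ + 1%:M]addrC.
    by rewrite det_mulmx det_lblock det_ublock !det1 !mulr1.
  apply: (@det_last_columns R n.+1 [set u | M u^T] _ pairing_image_ideal) => //.
  move=> i; rewrite /=; case: (splitP i) => j ij.
  + have -> : i = lshift n.+1 j by apply: val_inj.
    have -> : (\row_l block_mx C (C *m E) (- G) (1%:M - G *m E) (lshift n.+1 j)
        (rshift k l))^T = 0 - \sum_l (- C j l) *: f l.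
      apply/colP => l; rewrite mxE [LHS]mxE block_mxEur.
      have := congr1 (fun u : 'cV_n.+1 => u l 0) (rowE _ C j).
      rewrite !mxE => ->; rewrite add0r !summxE -sumrN; apply: eq_bigr => h _.
      by rewrite !mxE mulNr opprK.
    apply: relM; have [u Mu uE] := relC j; exists u => //.
    rewrite uE T0 add0r -sumrN; apply: eq_bigr => l _.
    by rewrite scaleNr opprK.
  + have -> : i = rshift k j by apply: val_inj.
    have -> : (\row_l block_mx C (C *m E) (- G) (1%:M - G *m E) (rshift k j)
        (rshift k l))^T = delta_mx j 0 - \sum_l D j l *: f l.
      apply/colP => l; rewrite mxE [LHS]mxE block_mxEdr.
      have := congr1 (fun u : 'cV_n.+1 => u l 0) (rowE _ G j).
      rewrite !mxE => ->; rewrite !summxE eqxx andbT eq_sym; congr (_ - _).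
      by apply: eq_bigr => h _; rewrite !mxE.
    exact: DP.
- move=> _ [w Mw <-]; rewrite -(det_syzygies y w x0).
  apply: (@span_gen _ R^o).
  exists n.+1, (fun i => T (delta_mx i 0)).
  exists (\matrix_(i < n.+1, j < n.+1)
    if i == 0%N :> nat then w j 0 else syzygy x y n i j 0); split=> //.
    rewrite -Trange; apply/seteqP; split=> [_ [u _ <-]|].
      rewrite [u]vector_sum Tsum; apply: span_sum => i; apply: spanZ.
      by apply: span_gen; left; exists i.
    apply: span_over_min => [|_ _ [u _ <-] [v _ <-]|c _ _ [[i _ <-]|[u Mu <-]]].
    + by exists 0.
    + by exists (u + v) => //; rewrite TD.
    + by exists (c *: delta_mx i 0) => //; rewrite TZ.
    + by exists (c *: u) => //; rewrite TZ TM.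
  move=> i; have [i0|i0] := eqVneq (i : nat) 0%N.
    exists w => //; rewrite -TM // {1}[w]vector_sum Tsum; apply: eq_bigr => j _.
    by rewrite mxE i0.
  have Mi : M (syzygy x y n i) by apply: Mg; rewrite lt0n i0 -ltnS ltn_ord.
  exists (syzygy x y n i) => //.
  rewrite -TM // {1}[syzygy _ _ _ _]vector_sum Tsum; apply: eq_bigr => j _.
  by rewrite [in RHS]mxE (negPf i0).
Qed.

End DoubleDual.


(** * Maximal minors of the generators *)

Section DeterminantSpan.
Variables (R : comNzRingType) (e : nat) (G : set 'cV[R]_e) (J : set R).
Hypotheses (iJ : is_ideal J)
  (GJ : forall W : 'M[R]_e, (forall i, G (row i W)^T) -> J (\det W)).

Let replace (W : 'M[R]_e) (s : 'I_e) (u : 'cV[R]_e) : 'M[R]_e :=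
  \matrix_(i, j) if i == s then u j 0 else W i j.

Let row_replace W s u i : (row i (replace W s u))^T = if i == s then u else (row i W)^T.
Proof. by apply/colP => j; rewrite !mxE; case: ifP => _ //; rewrite !mxE. Qed.

Let det_replace W s a u v :
  \det (replace W s (a *: u + v)) = a * \det (replace W s u) + \det (replace W s v).
Proof.
rewrite -[\det (replace W s v)]mul1r; apply: (@determinant_multilinear _ _ _ _ _ s).
- by apply/rowP => j; rewrite !mxE eqxx mul1r.
- by apply/matrixP => i j; rewrite !mxE eq_sym (negPf (neq_lift _ _)).
- by apply/matrixP => i j; rewrite !mxE eq_sym (negPf (neq_lift _ _)).
Qed.

(** Multilinearity, one row at a time. *)
Lemma det_span (W : 'M[R]_e) :
  (forall i, span G (row i W)^T) -> J (\det W).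
Proof.
suff H s : forall W : 'M[R]_e, (forall i, span G (row i W)^T) ->
    (forall i : 'I_e, (s <= i)%N -> G (row i W)^T) -> J (\det W).
  by move=> GW; apply: (H e) => // i; rewrite leqNgt ltn_ord.
have [J0 JD JM] := iJ.
elim: s => [|s IH] {}W GW Ws; first by apply: GJ => i; exact: Ws.
have [se|es] := ltnP s e; last first.
  by apply: IH => // i si; have := leq_trans es si; rewrite leqNgt ltn_ord.
pose t := Ordinal se.
have -> : W = replace W t (row t W)^T.
  by apply/matrixP => i j; rewrite !mxE; case: eqP => // ->.
move: (row t W)^T (GW t).
apply: (@span_over_min _ _ _ _ [set u | J (\det (replace W t u))]) => /=.
- have := det_replace W t (-1) 0 0; rewrite scaler0 addr0 mulN1r addNr => ->.
  exact: J0.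
- by move=> u v Ju Jv; rewrite -[u]scale1r det_replace mul1r; exact: JD.
- move=> a u _ Gu; have := det_replace W t (a - 1) u u.
  rewrite -{2}[u]scale1r -scalerDl subrK => ->.
  rewrite -{2}[\det _]mul1r -mulrDl subrK; apply: JM.
  apply: IH => i; rewrite row_replace; case: eqP => // it.
    exact: span_gen.
  move=> si; apply: Ws; rewrite ltn_neqAle si andbT.
  by apply/eqP => si'; apply: it; apply: val_inj.
Qed.

End DeterminantSpan.

(** Each term of the determinant has one factor from the first column and [k]
    factors from [(x, y)]; the factor [z] gathers those already split off. *)
Lemma det_first_column (R : comNzRingType) (x y : R) (J : set R) k (A : 'M[R]_k.+1) z :
  is_ideal J ->
  (forall i u w, (u + w = k)%N -> J (z * A i 0 * x ^+ u * y ^+ w)) ->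
  (forall i j, j != 0 -> exists p q, A i j = p * x + q * y) ->
  J (z * \det A).
Proof.
move=> iJ; have [_ JD JM] := iJ; elim: k A z => [|k IH] A z head tail.
  by have := head 0 0%N 0%N erefl; rewrite !mulr1 det_mx11.
rewrite (expand_det_col A ord_max) mulr_sumr; apply: ideal_sum => // i _.
have [|p [q ->]] := tail i ord_max; first by rewrite -val_eqE.
rewrite /cofactor; set s := (-1) ^+ _; set D := \det _.
have lift0 : lift ord_max 0 = 0 :> 'I_k.+2 by apply: val_inj.
have minor t : (forall i u w, (u + w = k)%N -> J (z * t * A i 0 * x ^+ u * y ^+ w)) ->
    J (z * t * D).
  move=> ht; apply: IH => [i' u w uw|i' j j0].
    by rewrite !mxE lift0; exact: ht.
  rewrite !mxE; apply: tail; apply: contraNneq j0 => /(congr1 (@nat_of_ord _)).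
  by rewrite lift_max => j0; apply/eqP/val_inj.
rewrite (_ : z * _ = s * p * (z * x * D) + s * q * (z * y * D)); last by ring.
apply: JD; apply: (JM); apply: minor => i' u w uw.
- rewrite (_ : _ * _ = z * A i' 0 * x ^+ u.+1 * y ^+ w); last by rewrite exprS; ring.
  by apply: head; rewrite addSn uw.
- rewrite (_ : _ * _ = z * A i' 0 * x ^+ u * y ^+ w.+1); last by rewrite exprS; ring.
  by apply: head; rewrite addnS uw.
Qed.

Lemma decr_gap r a (a_decr : forall i, (i < r)%N -> (a i.+1 < a i)%N) i d :
  (i + d <= r)%N -> (a (i + d)%N + d <= a i)%N.
Proof.
elim: d => [|d IH] idr; first by rewrite !addn0.
have idr' : (i + d < r)%N by rewrite -addnS.
have := a_decr _ idr'; have := IH (ltnW idr'); rewrite !addnS; lia.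
Qed.

Lemma incr_gap r b (b_incr : forall i, (i < r)%N -> (b i < b i.+1)%N) i d :
  (i + d <= r)%N -> (b i + d <= b (i + d)%N)%N.
Proof.
elim: d => [|d IH] idr; first by rewrite !addn0.
have idr' : (i + d < r)%N by rewrite -addnS.
have := b_incr _ idr'; have := IH (ltnW idr'); rewrite !addnS; lia.
Qed.

Section Generators.
Variables (R : comNzRingType) (x y : R) (r n : nat) (a b : nat -> nat).
Hypotheses (a_decr : forall i, (i < r)%N -> (a i.+1 < a i)%N)
  (b_incr : forall i, (i < r)%N -> (b i < b i.+1)%N) (nr : (n < r)%N).
Let q := (r - n)%N.

Variable J : set R.
Hypotheses (iJ : is_ideal J)
  (Jf : forall i, (i <= q)%N -> J (x ^+ a i * y ^+ b i))
  (Jh : forall i, (1 <= i <= n)%N -> J (x ^+ (n - i) * y ^+ b (q + i)%N)).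

Lemma monomial_mem i s t : (i <= r)%N ->
  ((if (i <= q)%N then a i else r - i) <= s)%N -> (b i <= t)%N -> J (x ^+ s * y ^+ t).
Proof.
move=> ir; have [_ _ JM] := iJ.
case: (leqP i q) => [iq|qi] sa tb; rewrite -(subnK sa) -(subnK tb) !exprD mulrACA;
  apply: JM.
  exact: Jf.
have iE : i = (q + (i - q))%N by rewrite subnKC // ltnW.
rewrite (_ : r - i = n - (i - q))%N; last by rewrite /q; lia.
by rewrite {2}iE; apply: Jh; rewrite /q; lia.
Qed.

(** The generators with coordinates numbered from 0, seen in the first [k + 1]
    coordinates; those beyond that range vanish there. *)
Inductive generator (k : nat) (u : nat -> R) : Prop :=
| GenZero of (forall j, (j <= k)%N -> u j = 0)
| GenF i of (i <= q)%N
    & u = fun j => x ^+ (a i - n) * y ^+ b i * (j.+1 == 1%N)%:R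
| GenG i of (1 <= i <= k)%N
    & u = fun j => y * (j.+1 == i)%:R + x * (j.+1 == i.+1)%:R
| GenH i of (1 <= i <= k)%N
    & u = fun j => y ^+ (b (q + i)%N - i) * (j.+1 == i.+1)%:R.

Lemma exponent_h_pos i : (1 <= i <= n)%N -> (0 < b (q + i) - i)%N.
Proof. by move=> ?; have := @incr_gap r b b_incr 0 (q + i); rewrite /q add0n; lia. Qed.

(** The exponents [u] and [w] count the factors [x] and [y] from the [k] middle
    columns.  The first column contributes [y] here and a monomial of an [f] in
    [minor_h_f]; in both cases [w + 1] factors [x] are missing from the [x]-part
    of a generator of [J], and the generator that divides the product is the one
    [w + 1] places further on. *)
Lemma minor_h_y k u w : (k < n)%N -> (u + w = k)%N ->
  J (x ^+ (n - k.+1) * y ^+ (b (q + k.+1)%N - k.+1) * y * x ^+ u * y ^+ w).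
Proof.
move=> kn uw; rewrite (_ : _ * _ =
    x ^+ (n - k.+1 + u) * y ^+ (b (q + k.+1)%N - k.+1 + 1 + w)); last first.
  by rewrite !exprD; ring.
have := @incr_gap r b b_incr (q + w.+1) u; have := @incr_gap r b b_incr 0 (q + k.+1).
rewrite !add0n (_ : q + w.+1 + u = q + k.+1)%N; last by rewrite -uw; lia.
move=> g0 g1; apply: (@monomial_mem (q + w.+1)); move: g0 g1; rewrite /q.
- lia.
- case: ifP; lia.
- lia.
Qed.

Lemma minor_h_f k u w i : (k < n)%N -> (u + w = k)%N -> (i <= q)%N ->
  J (x ^+ (n - k.+1) * y ^+ (b (q + k.+1)%N - k.+1) *
     (x ^+ (a i - n) * y ^+ b i) * x ^+ u * y ^+ w).
Proof.
move=> kn uw iq; rewrite (_ : _ * _ =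
    x ^+ (n - k.+1 + (a i - n) + u) * y ^+ (b (q + k.+1)%N - k.+1 + b i + w)); last first.
  by rewrite !exprD; ring.
have := @incr_gap r b b_incr 0 i; have := @incr_gap r b b_incr (i + w.+1) (q - i + u).
have := @incr_gap r b b_incr 0 (q + k.+1).
rewrite !add0n (_ : i + w.+1 + (q - i + u) = q + k.+1)%N; last by rewrite -uw; lia.
have := @decr_gap r a a_decr i w.+1; have := @decr_gap r a a_decr i (r - i).
move=> g0 g1 g2 g3 g4; apply: (@monomial_mem (i + w.+1)); move: g0 g1 g2 g3 g4; rewrite /q in iq *.
- lia.
- case: ifP; lia.
- lia.
Qed.

(** Expand along the last coordinate.  It is nonzero only in the last relation
    and in the last [h]; the remaining minor is of the same kind in the first
    case, since no relation occurs twice, and in the second case it is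
    estimated by [det_first_column]. *)
Lemma det_generators k (W : 'I_k.+1 -> nat -> R) : (k <= n)%N ->
  (forall i, generator k (W i)) ->
  J (x ^+ (n - k) * \det (\matrix_(i, j < k.+1) W i j)).
Proof.
have [J0 JD JM] := iJ.
elim: k W => [|k IH] W kn gW.
  rewrite det_mx11 mxE.
  case: (gW 0) => [->|i iq ->|[]//|[]//] //; first by rewrite mulr0.
  rewrite mulr1 mulrA -exprD subn0 subnKC; first exact: Jf.
  have := @decr_gap r a a_decr i (r - i); rewrite /q in iq; lia.
have [[i1 [i2 [i12 Wi]]]|inj] :=
    pselect (exists i1 i2, i1 != i2 /\ W i1 = W i2).
  rewrite (determinant_alternate i12) ?mulr0 // => j.
  by rewrite !mxE Wi.
rewrite (expand_det_col _ ord_max) mulr_sumr; apply: ideal_sum => // i _.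
rewrite mxE /cofactor; set s := (-1) ^+ _; set D := \det _.
have DE : D = \det (\matrix_(i', j < k.+1) W (lift i i') j).
  by congr (\det _); apply/matrixP => i' j; rewrite !mxE lift_max.
have zero : W i k.+1 = 0 -> J (x ^+ (n - k.+1) * (W i k.+1 * (s * D))).
  by move=> ->; rewrite mul0r mulr0.
case: (gW i) => [W0|l lq WE|l /andP[l1 lk] WE|l /andP[l1 lk] WE].
- by apply: zero; exact: W0.
- by apply: zero; rewrite WE mulr0.
- have [lE|lk'] := eqVneq l k.+1; last first.
    apply: zero; rewrite WE eqSS (eq_sym k.+1) (negPf lk') mulr0 addr0.
    by rewrite (gtn_eqF (leq_ltn_trans lk (ltnSn _))) mulr0.
  have -> : W i k.+1 = x.
    by rewrite WE lE eqxx (gtn_eqF (ltnSn k.+1)) mulr0 add0r mulr1.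
  rewrite (_ : x ^+ _ * _ = s * (x ^+ (n - k) * D)); last first.
    by rewrite -(subnSK kn) exprS; ring.
  apply: JM; rewrite DE; apply: (IH (fun i' => W (lift i i'))) => [|i']; first exact: ltnW.
  case: (gW (lift i i')) => [W0|h hq hE|h /andP[h1 hk] hE|h /andP[h1 hk] hE].
  + by apply: GenZero => j jk; apply: W0; exact: leqW.
  + exact: GenF hE.
  + apply: GenG (hE); rewrite h1 -ltnS ltn_neqAle hk andbT.
    apply: contra_notN inj => /eqP hk'; exists i, (lift i i').
    by rewrite neq_lift WE hE lE hk'.
  + have [hk'|hk'] := eqVneq h k.+1; last first.
      by apply: GenH hE; rewrite h1 -ltnS ltn_neqAle hk' hk.
    apply: GenZero => j jk; rewrite hE hk' eqSS.
    by rewrite (ltn_eqF (leq_ltn_trans jk (ltnSn _))) mulr0.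
- have [lE|lk'] := eqVneq l k.+1; last first.
    by apply: zero; rewrite WE eqSS (eq_sym k.+1) (negPf lk') mulr0.
  have -> : W i k.+1 = y ^+ (b (q + k.+1)%N - k.+1) by rewrite WE lE eqxx mulr1.
  rewrite (_ : x ^+ _ * (_ * (_ * _)) =
      s * (x ^+ (n - k.+1) * y ^+ (b (q + k.+1)%N - k.+1) * D)); last by ring.
  apply: JM; rewrite DE; apply: (det_first_column (x := x) (y := y)) => //.
  + move=> i' u w uw; rewrite mxE.
    case: (gW (lift i i')) => [->|h hq ->|h h1 ->|h h1 ->] //.
    * by rewrite mulr0 !mul0r.
    * by rewrite mulr1; exact: minor_h_f.
    * have [->|h1'] := eqVneq h 1%N.
        by rewrite mulr0 addr0 mulr1; exact: minor_h_y.
      have E' : (1%N == h.+1) = false by case: h h1 {h1'}.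
      by rewrite E' !mulr0n !mulr0 addr0 mulr0 !mul0r.
    * have E' : (1%N == h.+1) = false by case: h h1.
      by rewrite E' mulr0n !mulr0 !mul0r.
  + move=> i' j j0; rewrite mxE.
    case: (gW (lift i i')) => [W0|h hq ->|h h1 ->|h h1 ->].
    * exists 0, 0; rewrite W0 ?mul0r ?addr0 //.
      by rewrite ltnW // ltnS ltnW // ltn_ord.
    * by exists 0, 0; rewrite eqSS -val_eqE /= in j0 *; rewrite (negPf j0) mulr0 !mul0r addr0.
    * by exists (j.+1 == h.+1)%:R, (j.+1 == h)%:R; ring.
    * exists 0, (y ^+ (b (q + h)%N - h).-1 * (j.+1 == h.+1)%:R).
      have hn : (1 <= h <= n)%N by case/andP: h1 => -> hk; rewrite (leq_trans hk).
      by rewrite -{1}(prednK (exponent_h_pos hn)) exprS; ring.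
Qed.

End Generators.


(** * The module of a monomial ideal *)

Section ModuleOf.
Variables (R : idomainType) (m : set R) (x y : R).
Hypotheses (regR : regular_local_ring m 2) (m_gen : m = ideal_gen [set x; y]).
Variables (r n : nat) (a b : nat -> nat).
Hypotheses (a_decr : forall i, (i < r)%N -> (a i.+1 < a i)%N)
  (b_incr : forall i, (i < r)%N -> (b i < b i.+1)%N) (b_0 : b 0%N = 0%N)
  (n_gt0 : (0 < n)%N) (nr : (n < r)%N).
Let M := module_of x y r a b n.+1.
Let J := pairing x y @` M.
Let q := (r - n)%N.

Let e1 : (n.+1 - 1 = n)%N. Proof. by rewrite subn1. Qed.
Let qE : (r - n.+1 + 1 = q)%N. Proof. by rewrite addn1 subnSK. Qed.

Let a_ge i : (i <= r)%N -> (r - i <= a i)%N.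
Proof. by move=> ir; have := @decr_gap r a a_decr i (r - i); lia. Qed.

Let b_ge i : (i <= r)%N -> (i <= b i)%N.
Proof. by move=> ir; have := @incr_gap r b b_incr 0 i; rewrite add0n; lia. Qed.

Let M0 : M 0. Proof. exact: span_over0. Qed.
Let MD u v : M u -> M v -> M (u + v). Proof. exact: span_overD. Qed.
Let MZ c u : M u -> M (c *: u). Proof. exact: spanZ. Qed.

Let Mf i : (i <= q)%N -> M ((x ^+ (a i - n) * y ^+ b i) *: eps R n.+1 1).
Proof.
by move=> iq; apply: span_gen; left; left; exists i; rewrite /= ?qE // e1.
Qed.

Let Mg i : (1 <= i <= n)%N -> M (syzygy x y n i).
Proof. by move=> hi; apply: span_gen; left; right; exists i; rewrite /= ?e1. Qed.

Let Mh i : (1 <= i <= n)%N -> M (y ^+ (b (q + i)%N - i) *: eps R n.+1 i.+1).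
Proof.
by move=> hi; apply: span_gen; right; exists i; rewrite /= ?e1 // qE.
Qed.

Let Mm u i : M u -> m (u i 0).
Proof.
have [noeth loc _ _] := regR; have [m0 mD mM] := max_ideal loc.
have mx : m x by apply/(max_xy m_gen); exists 1, 0; ring.
have my : m y by apply/(max_xy m_gen); exists 0, 1; ring.
have mpow t k : m t -> (0 < k)%N -> m (t ^+ k).
  by case: k => // k mt _; rewrite exprSr; exact: mM.
suff sub : M `<=` [set v | m (v i 0)] by exact: sub.
apply: span_over_min => [|v w mv mw|c v _]; rewrite /= ?mxE //; first exact: mD.
rewrite qE e1 => -[[[j jq <-]|[j /andP[j1 jn] <-]]|[j hj <-]];
  rewrite !mxE; apply: (mM).
- rewrite mulrC; apply: (mM); case: j jq => [|j] /= jq.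
    rewrite b_0 mulr1; apply: mpow => //.
    by have := @a_ge 0 isT; rewrite /q in jq *; lia.
  by apply: (mM); apply: mpow => //; have := @b_ge j.+1; rewrite /q in jq *; lia.
- by apply: mD; rewrite mulrC; exact: mM.
- rewrite mulrC; apply: (mM); apply: mpow => //.
  exact: (exponent_h_pos b_incr nr hj).
Qed.

Let iJ : is_ideal J.
Proof. exact: pairing_image_ideal. Qed.

(** The image of the module is the monomial ideal obtained from the given one
    by lowering the last exponents of [x] to [n - 1, ..., 0]. *)
Let Jf i : (i <= q)%N -> J (x ^+ a i * y ^+ b i).
Proof.
move=> iq; exists ((x ^+ (a i - n) * y ^+ b i) *: eps R n.+1 1); first exact: Mf.
rewrite pairingZ pairing_eps // expr0 subn0 mul1r mulr1 mulrAC -exprD subnK //.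
by have := @a_ge i; rewrite /q in iq; lia.
Qed.

Let Jh i : (1 <= i <= n)%N -> J (x ^+ (n - i) * y ^+ b (q + i)%N).
Proof.
move=> hi; have [_ _ JM] := iJ; case/andP: (hi) => i1 lin.
exists ((-1) ^+ i *: (y ^+ (b (q + i)%N - i) *: eps R n.+1 i.+1)).
  by apply: MZ; exact: Mh.
rewrite !pairingZ pairing_eps //.
have -> : y ^+ b (q + i)%N = y ^+ (b (q + i)%N - i) * y ^+ i.
  by rewrite -exprD subnK //; have := @b_ge (q + i); rewrite /q; lia.
rewrite (_ : _ * _ = ((-1) ^+ i * (-1) ^+ i) *
  (x ^+ (n - i) * (y ^+ (b (q + i)%N - i) * y ^+ i))); last by ring.
by rewrite -exprMn mulrNN mulr1 expr1n mul1r.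
Qed.

Let Jx : J (x ^+ a 0%N).
Proof. by have := Jf (leq0n q); rewrite b_0 mulr1. Qed.

Let Jy : J (y ^+ b r).
Proof.
have := @Jh n; rewrite n_gt0 leqnn subnn mul1r => /(_ isT).
by rewrite /q subnK // ltnW.
Qed.

Let Mpre w : J (pairing x y w) -> M w.
Proof. exact: (pairing_preimage regR m_gen M0 MD MZ Mg). Qed.

Let Mmul t (w : 'cV[R]_n.+1) : J t -> M (t *: w).
Proof.
move=> Jt; apply: Mpre; rewrite pairingZ mulrC.
by have [_ _] := iJ; apply.
Qed.

Let Mdet (W : 'M[R]_n.+1) : (forall i, M (row i W)^T) -> J (\det W).
Proof.
apply: det_span => // {}W GW.
have /choice[U UP] : forall i, exists u : nat -> R,
    generator x y r n a b n u /\ forall j : 'I_n.+1, W i j = u j.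
  move=> i; have WE j : W i j = (row i W)^T j 0 by rewrite !mxE.
  have := GW i; rewrite qE e1 => -[[[k kq E]|[k hk E]]|[k hk E]].
  - exists (fun j => x ^+ (a k - n) * y ^+ b k * (j.+1 == 1%N)%:R).
    by split=> [|j]; [exact: (@GenF _ _ _ _ _ _ _ _ _ k kq)|rewrite WE -E !mxE].
  - exists (fun j => y * (j.+1 == k)%:R + x * (j.+1 == k.+1)%:R).
    by split=> [|j]; [exact: (@GenG _ _ _ _ _ _ _ _ _ k hk)|rewrite WE -E !mxE].
  - exists (fun j => y ^+ (b (q + k)%N - k) * (j.+1 == k.+1)%:R).
    by split=> [|j]; [exact: (@GenH _ _ _ _ _ _ _ _ _ k hk)|rewrite WE -E !mxE].
have -> : W = \matrix_(i, j) U i j.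
  by apply/matrixP => i j; rewrite mxE; have [_] := UP i; apply.
have := det_generators a_decr b_incr nr iJ Jf Jh (leqnn n) (fun i => (UP i).1).
by rewrite subnn mul1r.
Qed.

Lemma closed_ideal_of_module :
  integrally_closed_ideal (ideal_of_module M) <-> integrally_closed_module M.
Proof.
rewrite (ideal_of_module_pairing regR m_gen M0 MD MZ
  (fun w => Mmul w Jx) (fun w => Mmul w Jy) Mg Mdet).
apply: (closed_transfer regR m_gen M0 MD MZ Mg Mm).
by exists (a 0%N).
Qed.

End ModuleOf.

Theorem theorem3p8 (R : idomainType) (m : set R) (x y : R)
    (regR : regular_local_ring m 2)
    (residue_inf : infinite_set (residue_classes m))
    (m_gen : m = ideal_gen [set x; y])
    (r : nat) (a b : nat -> nat)
    (r_ge2 : (2 <= r)%N)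
    (a_decr : forall i, (i < r)%N -> (a i.+1 < a i)%N)
    (a_r : a r = 0%N)
    (b_0 : b 0%N = 0%N)
    (b_incr : forall i, (i < r)%N -> (b i < b i.+1)%N)
    (a0_le_br : (a 0%N <= b r)%N)
    (e : nat) (e_bounds : (2 <= e <= r)%N) :
  let M := module_of x y r a b e in
  integrally_closed_ideal (ideal_of_module M) <-> integrally_closed_module M.
Proof.
case: e e_bounds => [//|n] /andP[n1 nr].
exact: (closed_ideal_of_module regR m_gen).
Qed.
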